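(* Let $\mu\in\mathbb{R}$ and $0<t\le T$, let $\{W_s^{(\mu,1)}\}_{s\ge0}$ be a Brownian motion with drift $\mu$ and unit variance parameter, and let $M_t^{(\mu,1)}=\max_{0\le s\le t}W_s^{(\mu,1)}$. Let $F_{M_t}(\cdot;\mu)$ be the distribution function of $M_t^{(\mu,1)}$ and $\zeta_1(v)=F_{M_t}^{-1}(v;\mu)$. Then the copula $C_{W_T,M_t}(\cdot,\cdot;\mu)$ of the pair $(W_T^{(\mu,1)},M_t^{(\mu,1)})$ is given, for $(u,v)\in(0,1)^2$, by $$C_{W_T,M_t}(u,v;\mu)=\Phi_2\left(\Phi^{-1}(u),\frac{\zeta_1(v)-\mu t}{\sqrt t};\sqrt{\frac tT}\right)-e^{2\mu\zeta_1(v)}\,\Phi_2\left(\Phi^{-1}(u)-\frac{2\zeta_1(v)}{\sqrt T},\frac{-\zeta_1(v)-\mu t}{\sqrt t};\sqrt{\frac tT}\right).$$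
   Context: $\Phi$ denotes the standard normal distribution function, and $\Phi_2(z_1,z_2;\rho)=\mathbb{P}\{Z_1\le z_1,Z_2\le z_2\}$ where $(Z_1,Z_2)$ is a (possibly degenerate) bivariate normal vector with standard normal margins and correlation $\rho\in[-1,1]$. A Brownian motion with drift $\mu$ and unit variance parameter is the process $W_s^{(\mu,1)}=W_s+\mu s$, where $\{W_s\}$ is a standard Brownian motion started at $0$. For a distribution function $F$, $F^{-1}(u)=\inf\{x: F(x)\ge u\}$ for $u\in(0,1)$. For random variables $X_1,X_2$ with continuous distribution functions $F_1,F_2$ and joint distribution function $F$, the copula of $(X_1,X_2)$ is the unique function $C:[0,1]^2\to[0,1]$ that is a distribution function with uniform margins and satisfies $F(x_1,x_2)=C(F_1(x_1),F_2(x_2))$ for all $x_1,x_2$; equivalently $C(u_1,u_2)=F(F_1^{-1}(u_1),F_2^{-1}(u_2))$ for $(u_1,u_2)\in(0,1)^2$. *)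

(* Defs.v *)
From HB Require Import structures.
From mathcomp Require Import all_boot all_order all_algebra.
From mathcomp Require Import all_classical all_reals all_analysis.
From mathcomp Require Import measurable_realfun.

Set Implicit Arguments.
Unset Strict Implicit.
Unset Printing Implicit Defensive.

Import Order.TTheory GRing.Theory Num.Theory.
Import numFieldNormedType.Exports.

Local Open Scope classical_set_scope.
Local Open Scope ring_scope.

(** ** Distribution functions and copulas *)

Definition distr_fun d (T : measurableType d) (R : realType)
    (P : probability T R) (X : {RV P >-> R}) (x : R) : R :=
  fine (cdf X x).

Definition joint_distr_fun d (T : measurableType d) (R : realType)
    (P : probability T R) (X Y : {RV P >-> R}) (x y : R) : R :=
  fine (P [set w | X w <= x /\ Y w <= y]).

Definition quantile (R : realType) (F : R -> R) (u : R) : R :=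
  inf [set x | u <= F x].

(* Copulas are functions on the unit square; only the values of [C] at
   0 <= u, v <= 1 are meaningful. *)
Definition is_copula (R : realType) (C : R -> R -> R) : Prop :=
  exists Q : probability (R * R)%type R,
    [/\ forall A : set R, measurable A ->
          Q (A `*` setT) = uniform_prob (@ltr01 R) A,
        forall A : set R, measurable A ->
          Q (setT `*` A) = uniform_prob (@ltr01 R) A &
        forall u v : R, 0 <= u <= 1 -> 0 <= v <= 1 ->
          (C u v)%:E = Q (`]-oo, u] `*` `]-oo, v])].

Definition is_copula_of d (T : measurableType d) (R : realType)
    (P : probability T R) (X Y : {RV P >-> R}) (C : R -> R -> R) : Prop :=
  is_copula C /\
  forall x y : R,
    joint_distr_fun X Y x y = C (distr_fun X x) (distr_fun Y y).

(* Definite description; the copula is unique on the unit square when the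
   distribution functions of [X] and [Y] are continuous.  As [xget] returns an
   unspecified element of the set, and the zero function only if the set is
   empty, computing a nonzero value of [copula X Y] requires both the existence
   of a copula and the determination of its value for every candidate. *)
Definition copula d (T : measurableType d) (R : realType)
    (P : probability T R) (X Y : {RV P >-> R}) : R -> R -> R :=
  xget (fun _ _ => 0) [set C | is_copula_of X Y C].

(** ** Normal distribution functions *)

Definition Phi (R : realType) (z : R) : R :=
  fine (normal_prob 0 1 `]-oo, z]).

(* On R * R with two independent standard normal coordinates G1, G2, the linear
   image Z1 = G1, Z2 = rho G1 + sqrt (1 - rho^2) G2 is the (degenerate if
   |rho| = 1) normal vector with standard normal margins and correlation
   rho, for -1 <= rho <= 1. *)
Definition Phi2 (R : realType) (z1 z2 rho : R) : R :=
  let Z1 := fun g : R * R => g.1 in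
  let Z2 := fun g : R * R => rho * g.1 + Num.sqrt (1 - rho ^+ 2) * g.2 in
  fine ((normal_prob 0 1 \x normal_prob 0 1)%E
          [set g | Z1 g <= z1 /\ Z2 g <= z2]).

(** ** Brownian motion *)

(* Mutual independence of a finite family; taking some [A i] to be [setT] gives
   the product rule for the subfamilies. *)
Definition mutually_independent d (T : measurableType d) (R : realType)
    (P : probability T R) (n : nat) (X : 'I_n -> T -> R) : Prop :=
  forall A : 'I_n -> set R, (forall i, measurable (A i)) ->
    P (\bigcap_i (X i @^-1` A i)) = (\prod_(i < n) P (X i @^-1` A i))%E.

(* Time is the half-line [0, +oo[; the variables [W s] with s < 0 are never
   constrained nor used.  The times tau 0 <= ... <= tau n are the first terms
   of a nondecreasing sequence.  [normal_prob] is parameterized by the standard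
   deviation. *)
Record standard_brownian_motion d (T : measurableType d) (R : realType)
    (P : probability T R) (W : R -> {RV P >-> R}) : Prop := {
  bm_start : {ae P, forall w, W 0 w = 0} ;
  bm_independent_increments : forall (n : nat) (tau : nat -> R),
    0 <= tau 0%N -> {homo tau : i j / (i <= j)%N >-> i <= j} ->
    mutually_independent P (fun i : 'I_n => W (tau i.+1) \- W (tau i)) ;
  bm_normal_increments : forall s t : R, 0 <= s -> s < t ->
    forall A : set R, measurable A ->
      P ((W t \- W s) @^-1` A) = normal_prob 0 (Num.sqrt (t - s)) A ;
  bm_continuous_paths :
    {ae P, forall w, {within `[0, +oo[, continuous (fun s => W s w)}} }.

Definition add_drift d (T : measurableType d) (R : realType)
    (P : probability T R) (W : R -> {RV P >-> R}) (mu s : R) : {RV P >-> R} :=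
  W s \+ cst (mu * s).

(* [M] is the maximum of [X s] over 0 <= s <= t.  As paths are only almost
   surely continuous, the maximum exists almost surely. *)
Definition is_running_max d (T : measurableType d) (R : realType)
    (P : probability T R) (X : R -> {RV P >-> R}) (t : R) (M : {RV P >-> R})
    : Prop :=
  {ae P, forall w, [set X s w | s in `[0, t]] (M w) /\
                   ubound [set X s w | s in `[0, t]] (M w)}.

(* Main.v *)
Require Import Defs.
From HB Require Import structures.
From mathcomp Require Import all_boot all_order all_algebra.
From mathcomp Require Import all_classical all_reals all_analysis.
From mathcomp Require Import measurable_realfun.
From mathcomp Require Import ring lra.

Set Implicit Arguments.
Unset Strict Implicit.
Unset Printing Implicit Defensive.

Import Order.TTheory GRing.Theory Num.Theory.
Import numFieldNormedType.Exports.

Local Open Scope classical_set_scope.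
Local Open Scope ring_scope.

(* Write [Z] for the drifted Brownian motion and [M] for its maximum up to time
   [t].  For a test function [p] vanishing above [0], let
   [q z = expR (- 2 * mu * z) * p (- z)] be its reflection.  Both have the same
   average under the law of every increment of [Z], because
   [E f(- Z_r) = E (expR (- 2 * mu * Z_r) * f(Z_r))].  Observe [Z] on a finite
   grid and condition on the first grid time at which [Z] exceeds [m]: the
   averages of [p (Z_t - m)] and [q (Z_t - m)] after that time differ by at most a
   constant times the overshoot, which vanishes with the mesh since paths are
   continuous.  Hence [E (p (Z_t - m); M > m) = E (q (Z_t - m); M > m)], without the
   strong Markov property.  Letting [p] tend to the indicator of [z <= a - m]
   gives, for [a < m],
     P (M > m, Z_t <= a) = expR (2 * mu * m) * P (Z_t <= a - 2 * m),
   an identity between finite measures, which is then multiplied by the law of the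
   increment [Z_T - Z_t], independent of [(Z_t, M)].  Both marginal distribution functions
   are continuous, so the copula exists by the probability integral transform, and
   its value at [(u, v)] is the joint distribution function at the quantiles. *)

(** * Normal distributions *)

(** Since [p] vanishes above 0, [q] vanishes below 0, so [q (Z_t - m)] can be nonzero only when Z_t
    > m, and there M > m almost surely. On the reflected side the restriction to M > m therefore
    drops out and only the normal law of Z_t remains: this is what turns the balance between [p] and
    [q] into a closed formula. The weight [expR (- 2 * mu * z)] is unbounded, so [p] is a trapezoid
    cut off far to the left, which keeps both functions bounded and Lipschitz. The trapezoid
    overshoots its right end slightly, hence the strict a < m in the limit; the level m itself is
    recovered because the law of Z_t has no atoms. Identities are stated as sums: uniqueness and
    product theorems apply to measures, and a difference of measures need not be one. The
    subtraction of the theorem is performed on real numbers at the end. Conditioning yields Z_t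
    first and then an independent increment, while [Phi2] lists the terminal value first; the
    symmetry of the bivariate normal density exchanges them. The case t = T is separate because the
    increment then degenerates. *)

Lemma finite_measure_cdf_unique (R : realType)
    (m1 m2 : {measure set R -> \bar R}) :
  (forall a, (m1 `]-oo, a]%classic < +oo)%E) ->
  (forall a, m1 `]-oo, a]%classic = m2 `]-oo, a]%classic) ->
  forall A, measurable A -> m1 A = m2 A.
Proof.
move=> m1fin m12.
have E a b : `]a, b]%classic = `]-oo, b] `\` `]-oo, a] :> set R.
  by rewrite -[RHS]setCK setCD setCitvl setUC -[LHS]setCK setCitv.
apply: (@measure_unique _ _ _ (@ocitv R) (fun n => `]- n%:R, n%:R]%classic)).
- by [].
- exact: ocitvI.
- by move=> n; exact: is_ocitv.
- apply/seteqP; split=> // x _; exists (Num.truncn `|x|).+1 => //=.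
  rewrite in_itv/=; have := truncnS_gt `|x|.
  by rewrite ltr_norml => /andP[-> /ltW].
- move=> _ [[a b] _ <-]/=; rewrite E.
  have [ab|ba] := leP a b; last first.
    by rewrite -E set_itv_ge ?measure0// bnd_simp -leNgt ltW.
  have sab : (`]-oo, a] : set R) `<=` `]-oo, b].
    exact: subset_itvl.
  rewrite !measureD ?setIidr//; last 2 first.
  - by apply: le_lt_trans (m1fin b); rewrite [leRHS]m12.
  - exact: m1fin.
  by congr (_ - _)%E; exact: m12.
- move=> n; apply: le_lt_trans (m1fin n%:R).
  apply: le_measure; rewrite ?inE//; apply: subset_itvr; by [].
Qed.

Section normal_distribution_extra.
Local Open Scope ereal_scope.
Import HBNNSimple.

(** On sets, [normal_prob] is the integral of its density; linearity extends this to simple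
    functions and monotone convergence to every nonnegative [f]. *)
Lemma integral_normal_prob (R : realType) (m s : R) (f : R -> \bar R) :
  measurable_fun [set: R] f -> (forall x, 0 <= f x) ->
  \int[normal_prob m s]_x f x =
  \int[lebesgue_measure]_x (f x * (normal_pdf m s x)%:E).
Proof.
move=> mf f0.
have mpdf := measurable_normal_pdf m s.
have mf' : measurable_fun [set: measurableTypeR R] f := mf.
pose f_ := nnsfun_approx measurableT mf'.
have ndf a b x : (a <= b)%N -> (f_ a x <= f_ b x)%R.
  by move=> ab; have /lefP := nd_nnsfun_approx measurableT mf' ab; exact.
have mf_ k : measurable_fun [set: measurableTypeR R] (f_ k).
  exact: (@measurable_funPT _ _ _ _ (f_ k)).
have fE x : f x = limn (fun n => (f_ n x)%:E).
  by apply/esym/cvg_lim => //; exact: cvg_nnsfun_approx.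
under [RHS]eq_integral => x _.
  rewrite fE muleC -limeMl//; last first.
    by apply/cvg_ex; eexists; apply: cvg_nnsfun_approx.
  over.
rewrite monotone_convergence//; last 3 first.
- move=> k; apply: emeasurable_funM; apply/measurable_EFinP; [exact: mpdf|exact: mf_].
- by move=> n x _; rewrite mule_ge0 ?lee_fin ?normal_pdf_ge0.
- move=> x _ a b ab; apply: lee_wpmul2l; rewrite ?lee_fin ?normal_pdf_ge0//.
  exact: ndf.
under [LHS]eq_integral do rewrite fE.
rewrite monotone_convergence//; last 3 first.
- by move=> k; apply/measurable_EFinP; exact: mf_.
- by move=> n x _; rewrite lee_fin.
- by move=> x _ a b ab; rewrite lee_fin; exact: ndf.
congr (limn _); apply/funext => n.
under [LHS]eq_integral do rewrite fimfunE -fsumEFin//.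
rewrite ge0_integral_fsum//; last 2 first.
- by move=> r; exact/measurable_EFinP/measurableT_comp.
- by move=> r x _; rewrite nnfun_muleindic_ge0.
under [RHS]eq_integral => x _.
  rewrite fimfunE -fsumEFin// ge0_mule_fsumr; last first.
    by move=> r; rewrite EFinM nnfun_muleindic_ge0.
  over.
rewrite ge0_integral_fsum//; last 2 first.
- move=> r; apply: emeasurable_funM; apply/measurable_EFinP => //.
  exact: measurableT_comp.
- move=> r x _; apply: mule_ge0; first by rewrite lee_fin normal_pdf_ge0.
  by rewrite EFinM nnfun_muleindic_ge0.
apply: eq_fsbigr => r _.
rewrite integralZl_indic_nnsfun// integral_indic// setIT.
transitivity (r%:E * \int[@lebesgue_measure R]_x
    (((fun x => (normal_pdf m s x)%:E) \_ (f_ n @^-1` [set r])) x)).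
  by congr (_ * _); exact: integral_mkcond.
(* A negative value has empty preimage under a nonnegative simple function; only a value [r] >= 0
   has to be moved through the integral. *)
have [r0|r0] := leP 0%R r; last first.
  rewrite preimage_nnfun0// patch_set0 integral0 mule0.
  by under eq_integral do rewrite indicE in_set0 mulr0 mule0; rewrite integral0.
rewrite -ge0_integralZl//; last 2 first.
- apply/(measurable_restrictT _ _).1 => //.
  by apply: measurable_funTS; exact/measurable_EFinP.
- by move=> x _; rewrite patchE; case: ifP => // _; rewrite lee_fin normal_pdf_ge0.
apply: eq_integral => x _; rewrite patchE indicE.
by case: ifP => _; rewrite ?mulr1 ?mulr0 ?mule0 ?mule0// muleC.
Qed.

End normal_distribution_extra.

Definition mfun_of d1 d2 (T1 : measurableType d1) (T2 : measurableType d2)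
    (f : T1 -> T2) (mf : measurable_fun [set: T1] f) : {mfun T1 >-> T2} :=
  HB.pack f (isMeasurableFun.Build _ _ _ _ f mf).

Lemma measurable_affine (R : realType) (a c : R) :
  measurable_fun [set: measurableTypeR R]
    ((fun x => a * x + c) : measurableTypeR R -> measurableTypeR R).
Proof. by apply: measurable_funD => //; apply: measurable_funM. Qed.

Lemma lebesgue_measure_affine (R : realType) (a c : R) (A : set R) :
  0 < a -> measurable A ->
  lebesgue_measure A =
  (a%:E * lebesgue_measure ((fun x => a * x + c)%R @^-1` A))%E.
Proof.
move=> a0 mA.
pose f := mfun_of (measurable_affine a c).
pose r : {nonneg R} := NngNum (ltW a0).
rewrite (@lebesgue_measure_unique R
  (mscale r (pushforward (@lebesgue_measure R) f)))//= => _ [[x y] _ <-].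
rewrite /mscale/= /pushforward.
have -> : f @^-1` `]x, y] = `](x - c) / a, (y - c) / a]%classic.
  apply/seteqP; split => z/=; rewrite !in_itv/= ltr_pdivrMr// ler_pdivlMr//;
    by rewrite ltrBlDr lerBrDr mulrC.
rewrite /= !lebesgue_measure_itv/= !lte_fin ltr_pM2r ?invr_gt0// ltrD2r.
case: ifPn => _; rewrite ?mule0//.
by rewrite -!EFinB -EFinM; congr (_%:E); field; rewrite gt_eqF.
Qed.

Lemma normal_pdf_affine (R : realType) (a c m s x : R) : 0 < a -> 0 < s ->
  normal_pdf m s x = a * normal_pdf (a * m + c) (a * s) (a * x + c).
Proof.
move=> a0 s0.
rewrite !normal_pdfE ?gt_eqF ?mulr_gt0// mulrA; congr (_ * _).
  have -> : normal_peak (a * s) = (a * Num.sqrt (s ^+ 2 * pi *+ 2))^-1.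
    rewrite /normal_peak exprMn -mulrA -[_ *+ 2]mulrnAr.
    by rewrite sqrtrM ?sqr_ge0// sqrtr_sqr gtr0_norm.
  by rewrite invfM mulrA divff ?gt_eqF// mul1r.
rewrite /normal_fun; congr expR.
have -> : a * x + c - (a * m + c) = a * (x - m) by ring.
by field; rewrite !gt_eqF.
Qed.

(** Change of variable in the density. It serves with [a = 1] to add a drift, with [a = s^-1] to
    standardize, and for the conditional law of the second coordinate of a bivariate normal pair. *)
Lemma normal_prob_affine (R : realType) (a c m s : R) (A : set R) :
  0 < a -> 0 < s -> measurable A ->
  normal_prob m s ((fun x => a * x + c) @^-1` A) =
  normal_prob (a * m + c) (a * s) A.
Proof.
move=> a0 s0 mA; pose f := mfun_of (measurable_affine a c).
pose r : {nonneg R} := NngNum (ltW a0).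
have mpdf := measurable_normal_pdf (a * m + c) (a * s).
have mfA : measurable (f @^-1` A).
  by rewrite -[_ @^-1` _]setTI; exact: measurable_affine.
rewrite /normal_prob.
rewrite [RHS](eq_measure_integral
  (mscale r (pushforward (@lebesgue_measure R) f))); last first.
  by move=> B mB _; exact: lebesgue_measure_affine.
rewrite ge0_integral_mscale//; last 2 first.
- by apply: measurable_funTS; exact/measurable_EFinP.
- by move=> x _; rewrite lee_fin normal_pdf_ge0.
transitivity (r%:num%:E * \int[@lebesgue_measure R]_(x in f @^-1` A)
    (normal_pdf (a * m + c) (a * s) (f x))%:E)%E; last first.
  congr (_ * _)%E; apply/esym; apply: ge0_integral_pushforward => //.
    by apply: measurable_funTS; exact/measurable_EFinP.
  by move=> x _; rewrite lee_fin normal_pdf_ge0.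
rewrite -ge0_integralZl//; last 2 first.
- apply: measurable_funTS; apply/measurable_EFinP.
  by apply: measurableT_comp => //; exact: measurable_affine.
- by move=> x _; rewrite lee_fin normal_pdf_ge0.
by apply: eq_integral => x _; rewrite -EFinM (normal_pdf_affine c m x a0 s0).
Qed.

Lemma normal_prob_set1 (R : realType) (m s x : R) :
  normal_prob m s [set x] = 0%E.
Proof.
have /null_content_dominatesP := normal_prob_dominates m s.
by apply => //; exact: lebesgue_measure_set1.
Qed.

(* [dN(- x) = expR (- 2 * mu * x) dN(x)] for the law [N] at time [s ^+ 2] of the
   Brownian motion with drift [mu]: this replaces Girsanov's theorem. *)
Lemma normal_prob_reflect (R : realType) (mu s : R) (f : R -> R) :
  s != 0 -> measurable_fun [set: R] f -> (forall x, 0 <= f x) ->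
  (\int[normal_prob (mu * s ^+ 2) s]_x (f (- x))%:E =
   \int[normal_prob (mu * s ^+ 2) s]_x (expR (- 2 * mu * x) * f x)%:E)%E.
Proof.
move=> s0 mf f0.
have mN : measurable_fun [set: measurableTypeR R]
    (-%R : measurableTypeR R -> measurableTypeR R).
  exact: oppr_measurable.
pose N := mfun_of mN.
have mfN : measurable_fun [set: R] (fun x => f (- x)) by exact: measurableT_comp.
have mE : measurable_fun [set: R] (fun x => expR (- 2 * mu * x)).
  by apply: measurableT_comp => //; exact: measurable_funM.
rewrite !integral_normal_prob; last 4 first.
- by apply/measurable_EFinP; exact: measurable_funM.
- by move=> x; rewrite lee_fin mulr_ge0 ?expR_ge0.
- exact/measurable_EFinP.
- by move=> x; rewrite lee_fin.
rewrite [RHS](eq_measure_integral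
  (pushforward (@lebesgue_measure R) N)); last first.
  by move=> B mB _; exact/esym/lebesgue_measureN.
transitivity (\int[@lebesgue_measure R]_x ((expR (- 2 * mu * - x) * f (- x))%:E
    * (normal_pdf (mu * s ^+ 2) s (- x))%:E))%E; last first.
  apply/esym; apply: ge0_integral_pushforward => //.
    apply: emeasurable_funM; apply/measurable_EFinP.
      exact: measurable_funM.
    exact: measurable_normal_pdf.
  move=> x _; apply: mule_ge0; rewrite lee_fin ?normal_pdf_ge0//.
  by rewrite mulr_ge0 ?expR_ge0.
apply: eq_integral => x _ /=.
rewrite -!EFinM !normal_pdfE//; congr (_%:E).
rewrite /normal_fun mulrAC (mulrC (f _)) mulrA; congr (_ * _).
rewrite mulrCA -mulrA -expRD; congr (_ * expR _).
by field.
Qed.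

Lemma normal_pdf_shift (R : realType) (m s x : R) : s != 0 ->
  normal_pdf m s x = normal_pdf 0 s (x - m).
Proof. by move=> s0; rewrite !normal_pdfE// /normal_fun subr0. Qed.

(** Both sides are the density at (x, y) of the standard normal pair with correlation [r]: by r^2 +
    s^2 = 1 the exponent is - (x^2 + y^2 - 2 r x y) / (2 s^2), which is symmetric. *)
Lemma normal_pdf_bivariate_sym (R : realType) (r s x y : R) :
  0 < s -> r ^+ 2 + s ^+ 2 = 1 ->
  normal_pdf 0 1 x * normal_pdf (r * x) s y =
  normal_pdf 0 1 y * normal_pdf (r * y) s x.
Proof.
move=> s0 rs; rewrite !normal_pdfE ?gt_eqF// /normal_fun.
rewrite mulrACA [RHS]mulrACA -!expRD; congr (_ * expR _).
have E u v : - (u - 0) ^+ 2 / (1 ^+ 2 *+ 2) + - (v - r * u) ^+ 2 / (s ^+ 2 *+ 2)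
    = - (u ^+ 2 + v ^+ 2 - 2 * r * (u * v)) / (s ^+ 2 *+ 2).
  have -> : u ^+ 2 + v ^+ 2 = (r ^+ 2 + s ^+ 2) * u ^+ 2 + v ^+ 2.
    by rewrite rs mul1r.
  by field; rewrite gt_eqF.
by rewrite !E [x ^+ 2 + _]addrC [x * y]mulrC.
Qed.

Lemma normal_bivariate_sym (R : realType) (r s z1 z2 : R) :
  0 < s -> r ^+ 2 + s ^+ 2 = 1 ->
  ((normal_prob 0 1 \x normal_prob 0 1)
     [set g : R * R | (g.1 <= z1)%R /\ (r * g.1 + s * g.2 <= z2)%R] =
   (normal_prob 0 1 \x normal_prob 0 1)
     [set g : R * R | (g.1 <= z2)%R /\ (r * g.1 + s * g.2 <= z1)%R])%E.
Proof.
move=> s0 rs.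
pose F a b (z : measurableTypeR R * measurableTypeR R) : \bar R :=
  (\1_(`]-oo, a]%classic : set R) z.1 * \1_(`]-oo, b]%classic : set R) z.2
   * (normal_pdf 0 1 z.1 * normal_pdf 0 s (z.2 - r * z.1)))%:E.
have F0 a b z : (0 <= F a b z)%E.
  by rewrite lee_fin !mulr_ge0 ?normal_pdf_ge0.
have mF a b : measurable_fun setT (F a b).
  apply/measurable_EFinP; apply: measurable_funM; apply: measurable_funM.
  - exact: (measurableT_comp (measurable_indic _)).
  - exact: (measurableT_comp (measurable_indic _)).
  - exact: (measurableT_comp (measurable_normal_pdf _ _)).
  - apply: (measurableT_comp (measurable_normal_pdf _ _)).
    by apply: measurable_funB => //; apply: measurable_funM.
have mS a b : measurable [set g : measurableTypeR R * measurableTypeR R |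
    (g.1 <= a)%R /\ (r * g.1 + s * g.2 <= b)%R].
  apply: measurableI.
    rewrite -[X in measurable X]setTI; apply: (measurable_fun_le) => //.
  rewrite -[X in measurable X]setTI; apply: measurable_fun_le => //.
  by apply: measurable_funD; apply: measurable_funM.
(* For fixed first coordinate x, the substitution y = r x + s g2 turns the probability into the
   integral of the joint density over a quadrant; Tonelli and the symmetry of the density then
   conclude. *)
have key a b : ((normal_prob 0 1 \x normal_prob 0 1)
     [set g : R * R | (g.1 <= a)%R /\ (r * g.1 + s * g.2 <= b)%R] =
   \int[lebesgue_measure]_x \int[lebesgue_measure]_y F a b (x, y))%E.
  rewrite /product_measure1/= integral_normal_prob; last 2 first.
  - by apply: measurable_fun_xsection; exact: mS.
  - by move=> x.
  apply: eq_integral => x _ /=.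
  have -> : xsection [set g : R * R | (g.1 <= a)%R /\ (r * g.1 + s * g.2 <= b)%R] x
      = (fun y => s * y + r * x)%R @^-1`
        (if (x <= a)%R then `]-oo, b]%classic else set0).
    apply/seteqP; split=> y; rewrite /xsection/= inE/=.
      by case=> -> h; rewrite /= in_itv/= addrC.
    by case: ifPn => // _; rewrite /= in_itv/= addrC.
  rewrite normal_prob_affine//; last by case: ifP.
  rewrite mulr0 add0r mulr1 /normal_prob integral_mkcond.
  rewrite muleC -ge0_integralZl//; last 3 first.
  - apply/(measurable_restrictT _ _).1; first by case: ifP.
    by apply: measurable_funTS; apply/measurable_EFinP; exact: measurable_normal_pdf.
  - by move=> y _; rewrite patchE; case: ifP => // _; rewrite lee_fin normal_pdf_ge0.
  - by rewrite lee_fin normal_pdf_ge0.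
  apply: eq_integral => y _; rewrite /F/= patchE !indicE.
  have -> : (x \in (`]-oo, a]%classic : set R)) = (x <= a)%R.
    by apply/idP/idP; rewrite ?inE/= in_itv.
  have [xa|xa] := boolP (x <= a)%R; last by rewrite in_set0 mule0 !mul0r.
  case: ifPn => yb; last by rewrite mule0 mulr0 mul0r.
  by rewrite !mul1r -EFinM (normal_pdf_shift (r * x)) ?gt_eqF.
rewrite key [RHS]key.
transitivity (\int[@lebesgue_measure R]_y \int[@lebesgue_measure R]_x
    F z1 z2 (x, y))%E.
  exact: (@fubini_tonelli _ _ _ _ _ (@lebesgue_measure R) (@lebesgue_measure R)
    (F z1 z2) (mF z1 z2) (F0 z1 z2)).
apply: eq_integral => y _; apply: eq_integral => x _; rewrite /F /fst /snd.
rewrite -(normal_pdf_shift (r * x)) ?gt_eqF//.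
rewrite -(normal_pdf_shift (r * y)) ?gt_eqF//.
by rewrite (normal_pdf_bivariate_sym x y s0 rs) [X in (X * _)%:E]mulrC.
Qed.

(** * Independence of Brownian increments from the past *)

(* Events depending on all the [X i] but the last one. *)
Definition past_rectangles (T : Type) (R : realType) (n : nat)
    (X : 'I_n.+1 -> T -> R) : set (set T) :=
  [set E | exists A : 'I_n.+1 -> set R, [/\ forall i, measurable (A i),
     A ord_max = setT & E = \bigcap_i (X i @^-1` A i)]].

Lemma past_rectangles_setI_closed (T : Type) (R : realType) (n : nat)
    (X : 'I_n.+1 -> T -> R) : setI_closed (past_rectangles X).
Proof.
move=> _ _ [A [mA AT ->]] [B [mB BT ->]]; exists (fun i => A i `&` B i); split.
- by move=> i; exact: measurableI.
- by rewrite AT BT setIT.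
- apply/seteqP; split=> [w [Aw Bw] i _|w AB]; first by split; [apply: Aw|apply: Bw].
  by split=> i _; have [] := AB i I.
Qed.

Section independence.
Context d (T : measurableType d) (R : realType) (P : probability T R).

(** Pi-lambda argument: the events independent of the last coordinate form a lambda-system, and the
    rectangles are a pi-system inside it. *)
Lemma past_rectangles_independent (n : nat) (X : 'I_n.+1 -> T -> R) :
  (forall i, measurable_fun [set: T] (X i)) -> mutually_independent P X ->
  forall E, <<s past_rectangles X >> E -> forall B, measurable B ->
  measurable E /\
  P (E `&` X ord_max @^-1` B) = (P E * P (X ord_max @^-1` B))%E.
Proof.
move=> mX indX E sE B mB.
have mXi i A : measurable A -> measurable (X i @^-1` A).
  by move=> mA; rewrite -[_ @^-1` _]setTI; exact: mX.
set F := X ord_max @^-1` B.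
have mF : measurable F by exact: mXi.
have Ffin : P F \is a fin_num by exact: fin_num_measure.
pose H := [set E | measurable E /\ P (E `&` F) = (P E * P F)%E].
suff : <<s past_rectangles X >> `<=` H by move=> /(_ _ sE).
apply: lambda_system_subset => //; first exact: past_rectangles_setI_closed.
- apply/dynkin_lambda_system; split.
  + by split=> //; rewrite setTI probability_setT mul1e.
  + move=> A [mA PAF]; split; first exact: measurableC.
    have Afin : P A \is a fin_num by exact: fin_num_measure.
    rewrite setIC -setDE measureD// ?ltey_eq ?Ffin//.
    rewrite (setIC F A) [X in (_ - X)%E]PAF.
    by rewrite probability_setC// muleBl// ?mul1e.
  + move=> A tA HA.
    have mA i : measurable (A i) by have [] := HA i.
    split; first exact: bigcupT_measurable.
    rewrite setI_bigcupl !measure_bigcup//; last 2 first.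
    * by move=> i _; exact: measurableI.
    * exact: trivIset_setIr.
    rewrite muleC -[P F]fineK// -nneseriesZl//.
    by apply: eq_eseriesr => i _; have [_ AF] := HA i; rewrite [LHS]AF fineK// muleC.
- move=> _ [A [mA AT ->]]; split.
    by apply: fin_bigcap_measurable => // i _; exact: mXi.
  (* Replacing the trivial last side of the rectangle by [B] makes the intersection a rectangle
     again, so that mutual independence applies to both probabilities. *)
  pose A' i := if i == ord_max then B else A i.
  have -> : \bigcap_i X i @^-1` A i `&` F = \bigcap_i X i @^-1` A' i.
    apply/seteqP; split=> [w [Aw Fw] i _|w A'w].
      by rewrite /A'; case: eqVneq => [->|_]; [exact: Fw|exact: Aw].
    split=> [i _|]; last by have := A'w ord_max I; rewrite /A' eqxx.
    by have := A'w i I; rewrite /A'; case: eqVneq => [->|//]; rewrite AT.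
  rewrite !indX//; last by move=> i; rewrite /A'; case: ifP.
  rewrite !big_ord_recr/= AT preimage_setT probability_setT mule1.
  rewrite {2}/A' eqxx; congr (_ * _)%E; apply: eq_bigr => i _.
  rewrite /A' ifF//; apply/negbTE; rewrite neq_ltn /= ltn_ord//.
Qed.

(** Positions relative to [W (s 0)] are partial sums of increments, hence measurable for the
    sigma-algebra that the first [k] increments generate. *)
Lemma brownian_past_independent (W : R -> {RV P >-> R}) (s : nat -> R)
    (k : nat) (t : R) (C : nat -> set R) (B : set R) :
  standard_brownian_motion W -> 0 <= s 0%N ->
  {homo s : i j / (i <= j)%N >-> i <= j} -> s k <= t ->
  (forall j, measurable (C j)) -> measurable B ->
  let E := [set w | forall j, (j <= k)%N -> C j (W (s j) w - W (s 0%N) w)] in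
  P (E `&` (W t \- W (s k))%R @^-1` B) = (P E * P ((W t \- W (s k))%R @^-1` B))%E.
Proof.
move=> bW s0 s_nd skt mC mB E.
(* Appending [t] after [s k] makes [W t - W (s k)] the last of [k.+1] consecutive increments; [tau]
   then stays at [t], which keeps it nondecreasing. *)
pose tau j := if (j <= k)%N then s j else t.
have tau_nd : {homo tau : i j / (i <= j)%N >-> i <= j}.
  move=> i j ij; rewrite /tau; case: ifPn => ik; case: ifPn => // jk.
  - exact: s_nd.
  - by rewrite (le_trans _ skt)// s_nd.
  - by move: ik; rewrite (leq_trans ij jk).
pose X (i : 'I_k.+1) := W (tau i.+1) \- W (tau i).
have mX i : measurable_fun [set: T] (X i) by exact: measurable_funB.
have indX : mutually_independent P X.
  by apply: bm_independent_increments => //; rewrite /tau leq0n.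
have -> : W t \- W (s k) = X ord_max.
  by rewrite /X /tau/= ltnn leqnn.
pose G := past_rectangles X.
suff sE : <<s G >> E by have [] := past_rectangles_independent mX indX sE mB.
have mXG i : (i < k)%N ->
    measurable_fun [set: g_sigma_algebraType G] (X (inord i)).
  move=> ik _ A mA; rewrite setTI; apply: sub_sigma_algebra.
  exists (fun j => if j == inord i then A else setT); split.
  - by move=> j; case: ifP.
  - rewrite ifF//; apply/negbTE; rewrite neq_ltn/= inordK ?ik ?orbT//.
    by rewrite ltnS ltnW.
  - apply/seteqP; split=> [w Aw j _|w /(_ (inord i) I)]; last by rewrite eqxx.
    by case: eqVneq => [->|].
have mW j : (j <= k)%N -> measurable_fun [set: g_sigma_algebraType G]
    (fun w => W (s j) w - W (s 0%N) w : R).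
  elim: j => [_|j ih jk].
    under eq_fun do rewrite subrr.
    exact: measurable_cst.
  have -> : (fun w => W (s j.+1) w - W (s 0%N) w) =
      (fun w => (W (s j) w - W (s 0%N) w) + X (inord j) w).
    apply/funext => w; rewrite /X/= inordK ?ltnS 1?ltnW// /tau jk ltnW//.
    by rewrite [RHS]addrC addrA subrK.
  by apply: measurable_funD; [apply: ih; exact: ltnW|exact: mXG].
suff : measurable (E : set (g_sigma_algebraType G)) by [].
have -> : E = \bigcap_(j in [set j | (j <= k)%N])
    ((fun w => W (s j) w - W (s 0%N) w) @^-1` C j) by [].
apply: bigcap_measurable => [|j /= jk]; first by exists 0%N.
by rewrite -[_ @^-1` _]setTI; exact: mW.
Qed.

End independence.

(** * Integrating out an independent increment *)

Definition restricted_law d (T : measurableType d) (R : realType)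
    (P : probability T R) (U : {mfun T >-> R}) (E : set T)
    (mE : measurable E) : set R -> \bar R :=
  pushforward (mrestr P mE) U.

Section restricted_law_measure.
Context d (T : measurableType d) (R : realType) (P : probability T R).
Variables (U : {mfun T >-> R}) (E : set T) (mE : measurable E).

Let restricted_law0 : restricted_law P U mE set0 = 0%E.
Proof. exact: measure0. Qed.

Let restricted_law_ge0 A : (0 <= restricted_law P U mE A)%E.
Proof. exact: measure_ge0. Qed.

Let restricted_law_sigma_additive : semi_sigma_additive (restricted_law P U mE).
Proof. exact: measure_semi_sigma_additive. Qed.

HB.instance Definition _ := isMeasure.Build _ _ _ (restricted_law P U mE)
  restricted_law0 restricted_law_ge0 restricted_law_sigma_additive.

Let restricted_law_finite : fin_num_fun (restricted_law P U mE).
Proof.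
move=> A mA; rewrite /restricted_law /pushforward /mrestr fin_num_measure//.
by apply: measurableI => //; rewrite -[_ @^-1` _]setTI; exact: measurable_funP.
Qed.

HB.instance Definition _ := @Measure_isFinite.Build _ _ _
  (restricted_law P U mE) restricted_law_finite.

End restricted_law_measure.

Lemma restricted_lawE d (T : measurableType d) (R : realType)
    (P : probability T R) (U : {mfun T >-> R}) (E : set T)
    (mE : measurable E) (A : set R) :
  restricted_law P U mE A = P (E `&` U @^-1` A).
Proof. by rewrite /restricted_law /pushforward /mrestr setIC. Qed.

Section independence_integral.
Context d (T : measurableType d) (R : realType) (P : probability T R).
Variables (U Y : {mfun T >-> R}) (E : set T) (mE : measurable E).
Hypothesis indUY : forall A B, measurable A -> measurable B ->
  P (E `&` U @^-1` A `&` Y @^-1` B) = (P (E `&` U @^-1` A) * P (Y @^-1` B))%E.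

Let UY : T -> R * R := fun w => (U w, Y w).

Let mUY : measurable_fun [set: T] UY.
Proof. exact: measurable_fun_pair. Qed.

(** [indUY] is the product formula on rectangles, and it determines the product measure. *)
Lemma restricted_joint_law (S : set (R * R)) : measurable S ->
  P (E `&` UY @^-1` S) = ((restricted_law P U mE) \x (distribution P Y))%E S.
Proof.
move=> mS; pose m' := pushforward (mrestr P mE) (mfun_of mUY).
rewrite [RHS](product_measure_unique (m' := m'))//.
  by rewrite setIC.
move=> A B mA mB.
transitivity (P (E `&` U @^-1` A `&` Y @^-1` B)).
  by rewrite -setIA setIC.
by rewrite indUY// -restricted_lawE.
Qed.

(** Freezing lemma: on [E] the joint law of [(U, Y)] is a product, so Tonelli allows [Y] to be
    averaged with [U] held fixed. *)
Lemma ge0_integral_independent (f : R * R -> \bar R) :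
  measurable_fun [set: R * R] f -> (forall z, 0 <= f z)%E ->
  (\int[P]_(w in E) f (U w, Y w) =
   \int[P]_(w in E) \int[distribution P Y]_y f (U w, y))%E.
Proof.
move=> mf f0.
pose m' := pushforward (mrestr P mE) (mfun_of mUY).
(* Integrating over [E] amounts to integrating against the restriction of [P] to [E], which gives no
   mass to the complement. *)
have E1 g : measurable_fun [set: T] g -> (forall w, 0 <= g w)%E ->
    (\int[P]_(w in E) g w = \int[mrestr P mE]_w g w)%E.
  move=> mg g0; transitivity (\int[mrestr P mE]_(w in E) g w)%E.
    apply: eq_measure_integral => A mA AE.
    by rewrite -[in LHS](setIidl AE).
  rewrite [RHS](@ge0_negligible_integral _ _ _ _ _ (~` E))//.
  - by rewrite setTD setCK.
  - exact: measurableC.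
  - by rewrite -[RHS](measure0 P) -(setICl E).
rewrite E1//; last exact: measurableT_comp.
rewrite E1; last 2 first.
- apply: (measurableT_comp
    (measurable_fun_fubini_tonelli_F (m2 := distribution P Y) f mf f0)).
  exact: measurable_funPT.
- by move=> w; exact: integral_ge0.
transitivity (\int[m']_z f z)%E.
  by rewrite ge0_integral_pushforward.
transitivity (\int[restricted_law P U mE \x distribution P Y]_z f z)%E.
  apply: eq_measure_integral => S mS _.
  transitivity (P (E `&` UY @^-1` S)); first by rewrite setIC.
  exact: restricted_joint_law.
rewrite fubini_tonelli1//.
rewrite ge0_integral_pushforward//.
- exact: measurable_fun_fubini_tonelli_F.
- by move=> w _; exact: integral_ge0.
Qed.

End independence_integral.

(** * Crossing times on a grid *)

(** Heine-Cantor, from the near-covering form of compactness of the segment. *)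
Lemma continuous_segment_uniform (R : realType) (f : R -> R) (a b e : R) :
  {within `[a, b], continuous f} -> 0 < e ->
  exists2 dl : R, 0 < dl & forall x y, a <= x <= b -> a <= y <= b ->
    `|x - y| < dl -> `|f x - f y| < e.
Proof.
move=> /subspace_continuousP fc e0.
pose Q (dl x : R) := forall y, a <= y <= b -> `|x - y| < dl -> `|f x - f y| < e.
have /compact_near_coveringP/near_covering_withinP cover :=
  @segment_compact R a b.
have : \forall dl \near 0^'+, `[a, b]%classic `<=` Q dl.
  apply: cover => x xab.
  have /cvgrPdist_lt/(_ (e / 2)) := fc _ xab.
  rewrite divr_gt0// => /(_ isT); rewrite near_withinE.
  move=> /nbhs_ballP[h /= h0 hf].
  (* With both radii equal to h / 2, a point within [dl] of a point of the ball is still within h of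
     its centre. *)
  exists (ball x (h / 2), [set dl | dl < h / 2]).
    split=> /=; first by apply: nbhsx_ballx; rewrite divr_gt0.
    by apply: nbhs_right_lt; rewrite divr_gt0.
  move=> [x' dl] [/= bx' dlh] x'ab y yab x'y.
  have fx' : `|f x - f x'| < e / 2.
    by apply: hf => //; apply: le_ball bx'; lra.
  have fy : `|f x - f y| < e / 2.
    apply: hf; last by rewrite /= in_itv.
    rewrite /ball/= in bx' *.
    have := ler_distD x' x y; lra.
  have := ler_distD (f x) (f x') (f y); rewrite (distrC (f x') (f x)); lra.
move=> near_cover.
have /filter_ex[dl [dl0 dlQ]] : \forall dl \near 0^'+,
    0 < dl /\ `[a, b]%classic `<=` Q dl.
  by apply: filterI near_cover; exact: nbhs_right_gt.
by exists dl => // x y xab; exact: dlQ.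
Qed.

Lemma grid_oscillation_cvg0 (R : realType) (f : R -> R) (t e : R) :
  0 < t -> {within `[0, t], continuous f} -> 0 < e ->
  \forall n \near \oo, forall j, (j <= n)%N ->
    `|f (t * j.+1%:R / n.+1%:R) - f (t * j%:R / n.+1%:R)| < e.
Proof.
move=> t0 /continuous_segment_uniform H e0; have [dl dl0 fdl] := H e e0.
near=> n => j jn; apply: fdl.
- by rewrite divr_ge0 ?mulr_ge0 ?(ltW t0)//= ler_pdivrMr// ler_pM2l// ler_nat.
- rewrite divr_ge0 ?mulr_ge0 ?(ltW t0)//= ler_pdivrMr// ler_pM2l// ler_nat.
  exact: leq_trans jn _.
rewrite -mulrBl -mulrBr -natrB// subSnn mulr1 gtr0_norm ?divr_gt0//.
rewrite ltr_pdivrMr// mulrC -ltr_pdivrMr//.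
near: n; apply: filterS (nbhs_infty_gtr (t / dl)) => n tn.
by rewrite (lt_trans tn)// ltr_nat.
Unshelve. all: by end_near. Qed.

(** The last grid point before [s] is within t / (n + 1) of it, and uniform continuity with
    tolerance [f s - m] keeps the path above [m] there. *)
Lemma grid_exceeds (R : realType) (f : R -> R) (t s m : R) :
  0 < t -> {within `[0, t], continuous f} -> 0 <= s <= t -> m < f s ->
  \forall n \near \oo, exists2 k, (k <= n.+1)%N & m < f (t * k%:R / n.+1%:R).
Proof.
move=> t0 /continuous_segment_uniform H /andP[s0 st] ms.
have [|dl dl0 fdl] := H (f s - m); first by rewrite subr_gt0.
near=> n.
pose k := Num.truncn (s * n.+1%:R / t).
have sn0 : 0 <= s * n.+1%:R / t by rewrite divr_ge0 ?mulr_ge0 ?(ltW t0).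
have /andP[k1 k2] := truncn_itv sn0.
rewrite -/k in k1 k2.
have kn : (k <= n.+1)%N.
  rewrite -(ler_nat R) (le_trans k1)// ler_pdivrMr// mulrC ler_pM2l//.
exists k => //.
have : `|s - t * k%:R / n.+1%:R| < dl.
  rewrite ger0_norm; last first.
    by rewrite subr_ge0 ler_pdivrMr// mulrC -ler_pdivlMr.
  apply: (@le_lt_trans _ _ (t / n.+1%:R)).
    rewrite lerBlDr -mulrDl -{1}[t]mulr1 -mulrDr addrC natr1.
    by rewrite ler_pdivlMr// (mulrC t) -ler_pdivrMr// ltW.
  rewrite ltr_pdivrMr// mulrC -ltr_pdivrMr//.
  near: n; apply: filterS (nbhs_infty_gtr (t / dl)) => n tn.
  by rewrite (lt_trans tn)// ltr_nat.
have sk0 : 0 <= t * k%:R / n.+1%:R <= t.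
  rewrite divr_ge0 ?mulr_ge0 ?(ltW t0)//= ler_pdivrMr// ler_pM2l// ler_nat//.
move=> h; have := ler_norm (f s - f (t * k%:R / n.+1%:R)).
have := fdl s _ _ sk0 h; rewrite s0 st => /(_ isT); lra.
Unshelve. all: by end_near. Qed.

(** Moving the starting point from [h] to 0 costs at most L |h| for [p], and moving it back costs as
    much for [q]. The alternative [C] comes from p <= C and q >= 0; it provides the dominating
    constant when the mesh tends to 0. *)
Lemma bounded_lipschitz_integral_le (R : realType) (Q : probability R R)
    (p q : R -> R) (C L h : R) :
  measurable_fun [set: R] p -> measurable_fun [set: R] q ->
  (forall x, 0 <= p x <= C) -> (forall x, 0 <= q x) ->
  (forall x y, `|p x - p y| <= L * `|x - y|) ->
  (forall x y, `|q x - q y| <= L * `|x - y|) ->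
  (\int[Q]_x (p x)%:E = \int[Q]_x (q x)%:E)%E ->
  (\int[Q]_x (p (h + x))%:E <=
   \int[Q]_x (q (h + x))%:E + (Num.min C (2 * L * `|h|))%:E)%E.
Proof.
move=> mp mq pC q0 pL qL pq.
have L0 : 0 <= L by have := pL 1 0; rewrite subr0 normr1 mulr1; exact: le_trans.
have mph : measurable_fun [set: R] (fun x => (p (h + x))%:E).
  apply/measurable_EFinP; apply: (measurableT_comp mp).
  exact: measurable_funD.
have mqh : measurable_fun [set: R] (fun x => (q (h + x))%:E).
  apply/measurable_EFinP; apply: (measurableT_comp mq).
  exact: measurable_funD.
have cstE c : (\int[Q]_x c%:E = c%:E)%E.
  by rewrite integral_cst// [X in (_ * X)%E]probability_setT mule1.
have [Ch|hC] := leP C (2 * L * `|h|).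
  rewrite -[leLHS]add0e; apply: leeD; first by apply: integral_ge0 => x _; rewrite lee_fin.
  rewrite -[leRHS]cstE; apply: ge0_le_integral => //.
  - by move=> x _; rewrite lee_fin; case/andP: (pC (h + x)).
  - by move=> x _; rewrite lee_fin; case/andP: (pC (h + x)).
have Lh0 : 0 <= L * `|h| by rewrite mulr_ge0.
apply: (@le_trans _ _ (\int[Q]_x (p x)%:E + (L * `|h|)%:E)%E).
  rewrite -[X in (_ + X)%E]cstE -ge0_integralD//; last 2 first.
  - by move=> x _; rewrite lee_fin; case/andP: (pC x).
  - exact/measurable_EFinP.
  apply: ge0_le_integral => //.
  - by move=> x _; rewrite lee_fin; case/andP: (pC (h + x)).
  - by apply: emeasurable_funD => //; exact/measurable_EFinP.
  - move=> x _; rewrite -EFinD lee_fin.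
    have := pL (h + x) x; rewrite addrK; have := ler_norm (p (h + x) - p x); lra.
rewrite pq.
have -> : (2 * L * `|h|)%:E = ((L * `|h|)%:E + (L * `|h|)%:E)%E.
  by rewrite -EFinD; congr (_%:E); ring.
rewrite addeA; apply: leeD => //.
rewrite -[X in (_ + X)%E]cstE -ge0_integralD//; last first.
  by move=> x _; rewrite lee_fin.
apply: ge0_le_integral => //.
- by move=> x _; rewrite lee_fin.
- exact/measurable_EFinP.
- by apply: emeasurable_funD.
- move=> x _; rewrite -EFinD lee_fin.
  have := qL x (h + x).
  have -> : `|x - (h + x)| = `|h| by rewrite opprD addrCA subrr addr0 normrN.
  have := ler_norm (q x - q (h + x)); lra.
Qed.

(* [E] is the event that the level [m] is first exceeded at a given time, [U] the
   position at that time and [Y] the increment up to the horizon: the averages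
   of [p] and [q] agree when started from the level itself, so that after the
   crossing they differ by the Lipschitz constant times the overshoot. *)
Lemma stopped_integral_le d (T : measurableType d) (R : realType)
    (P : probability T R) (U Y : {mfun T >-> R}) (E : set T)
    (p q : R -> R) (C L m : R) :
  measurable E ->
  (forall A B, measurable A -> measurable B ->
    P (E `&` U @^-1` A `&` Y @^-1` B) = (P (E `&` U @^-1` A) * P (Y @^-1` B))%E) ->
  measurable_fun [set: R] p -> measurable_fun [set: R] q ->
  (forall x, 0 <= p x <= C) -> (forall x, 0 <= q x) ->
  (forall x y, `|p x - p y| <= L * `|x - y|) ->
  (forall x y, `|q x - q y| <= L * `|x - y|) ->
  (\int[distribution P Y]_x (p x)%:E = \int[distribution P Y]_x (q x)%:E)%E ->
  (\int[P]_(w in E) (p (U w + Y w - m))%:E <=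
   \int[P]_(w in E) (q (U w + Y w - m))%:E +
   \int[P]_(w in E) (Num.min C (2 * L * `|U w - m|))%:E)%E.
Proof.
move=> mE ind mp mq pC q0 pL qL pq.
have L0 : 0 <= L by have := pL 1 0; rewrite subr0 normr1 mulr1; exact: le_trans.
have C0 : 0 <= C by have /andP[] := pC 0; exact: le_trans.
have min0 w : 0 <= Num.min C (2 * L * `|U w - m|) by rewrite le_min C0 !mulr_ge0.
pose F (f : R -> R) (z : R * R) : \bar R := (f (z.1 - m + z.2))%:E.
have mF f : measurable_fun [set: R] f -> measurable_fun [set: R * R] (F f).
  move=> mf; apply/measurable_EFinP; apply: (measurableT_comp mf).
  by apply: measurable_funD => //; apply: measurable_funB.
have FE (f : R -> R) : (forall x, 0 <= f x) -> measurable_fun [set: R] f ->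
    (\int[P]_(w in E) (f (U w + Y w - m))%:E =
     \int[P]_(w in E) \int[distribution P Y]_y (f (U w - m + y))%:E)%E.
  move=> f0 mf; rewrite -(@ge0_integral_independent _ _ _ _ U Y _ mE ind (F f))//.
  - by apply: eq_integral => w _; rewrite /F/= addrAC.
  - exact: mF.
  - by move=> z; rewrite lee_fin.
have p0 x : 0 <= p x by case/andP: (pC x).
have mint (f : R -> R) : (forall x, 0 <= f x) -> measurable_fun [set: R] f ->
    measurable_fun E (fun w => \int[distribution P Y]_y (f (U w - m + y))%:E)%E.
  move=> f0 mf; apply: measurable_funTS.
  have h := @measurable_fun_fubini_tonelli_F _ _ R R R (distribution P Y) (F f)
    (mF f mf) (fun z => f0 _).
  exact: (measurableT_comp h).
have mmin : measurable_fun E (fun w => (Num.min C (2 * L * `|U w - m|))%:E).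
  apply: measurable_funTS; apply/measurable_EFinP; apply: measurable_minr => //.
  apply: measurable_funM => //; apply: measurableT_comp => //.
  exact: measurable_funB.
rewrite (FE p)// (FE q)// -ge0_integralD//; last 3 first.
- by move=> w _; apply: integral_ge0 => y _; rewrite lee_fin.
- exact: mint.
- by move=> w _; rewrite lee_fin.
apply: ge0_le_integral => //.
- by move=> w _; apply: integral_ge0 => y _; rewrite lee_fin.
- exact: mint.
- by apply: emeasurable_funD => //; exact: mint.
- by move=> w _; exact: bounded_lipschitz_integral_le.
Qed.

(** * Brownian motion with drift and its increments *)

Section drifted_brownian_motion.
Context d (T : measurableType d) (R : realType) (P : probability T R).
Variables (W : R -> {RV P >-> R}) (mu : R).
Hypothesis bW : standard_brownian_motion W.

(** Subtracting [W 0] makes every path start at 0, while [W 0 = 0] holds only almost surely. *)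
Definition drifted (s : R) (w : T) : R := W s w - W 0 w + mu * s.

Definition drifted_increment (s t : R) (w : T) : R :=
  W t w - W s w + mu * (t - s).

Lemma measurable_drifted s : measurable_fun [set: T] (drifted s).
Proof. by apply: measurable_funD => //; exact: measurable_funB. Qed.

Lemma measurable_drifted_increment s t :
  measurable_fun [set: T] (drifted_increment s t).
Proof. by apply: measurable_funD => //; exact: measurable_funB. Qed.

Lemma drifted0 w : drifted 0 w = 0.
Proof. by rewrite /drifted subrr mulr0 addr0. Qed.

Lemma driftedD s t w : drifted s w + drifted_increment s t w = drifted t w.
Proof. by rewrite /drifted /drifted_increment; ring. Qed.

Lemma drifted_increment_law s t A : 0 <= s -> s < t -> measurable A ->
  P (drifted_increment s t @^-1` A) =
  normal_prob (mu * (t - s)) (Num.sqrt (t - s)) A.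
Proof.
move=> s0 st mA; have st0 : 0 < t - s by rewrite subr_gt0.
pose f : measurableTypeR R -> measurableTypeR R := fun x => 1 * x + mu * (t - s).
have mfA : measurable (f @^-1` A).
  by rewrite -[_ @^-1` _]setTI; exact: measurable_affine.
have -> : drifted_increment s t @^-1` A = (W t \- W s) @^-1` (f @^-1` A).
  by apply/seteqP; split=> w; rewrite /f/= mul1r.
rewrite (bm_normal_increments bW s0 st mfA).
have sqrt0 : 0 < Num.sqrt (t - s) by rewrite sqrtr_gt0.
have := @normal_prob_affine R 1 (mu * (t - s)) 0 _ A ltr01 sqrt0 mA.
by rewrite mulr0 add0r mul1r.
Qed.

Lemma drifted_law t A : 0 < t -> measurable A ->
  P (drifted t @^-1` A) = normal_prob (mu * t) (Num.sqrt t) A.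
Proof.
move=> t0 mA; rewrite -[in RHS](subr0 t) -drifted_increment_law//.
by congr (P _); apply/seteqP; split=> w; rewrite /drifted/= /drifted_increment subr0.
Qed.

Lemma drifted_increment_integral s t (f : R -> \bar R) : 0 <= s -> s < t ->
  measurable_fun [set: R] f -> (forall x, 0 <= f x)%E ->
  (\int[P]_w f (drifted_increment s t w) =
   \int[normal_prob (mu * (t - s)) (Num.sqrt (t - s))]_x f x)%E.
Proof.
move=> s0 st mf f0.
have mY : measurable_fun [set: T]
    (drifted_increment s t : T -> measurableTypeR R).
  exact: measurable_drifted_increment.
rewrite -(@ge0_integral_distribution _ _ _ _ _ P (mfun_of mY) f mf f0).
by apply: eq_measure_integral => A mA _; exact: drifted_increment_law.
Qed.

(** The drift is deterministic, so it only translates the test sets [C j] and [B]; [s 0 = 0]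
    identifies the positions with those relative to the start. *)
Lemma drifted_past_independent (s : nat -> R) (k : nat) (t : R)
    (C : nat -> set R) (B : set R) :
  s 0%N = 0 -> {homo s : i j / (i <= j)%N >-> i <= j} -> s k <= t ->
  (forall j, measurable (C j)) -> measurable B ->
  let E := [set w | forall j, (j <= k)%N -> C j (drifted (s j) w)] in
  measurable E /\
  P (E `&` drifted_increment (s k) t @^-1` B) =
  (P E * P (drifted_increment (s k) t @^-1` B))%E.
Proof.
move=> s0 s_nd skt mC mB E; split.
  have -> : E = \bigcap_(j in [set j | (j <= k)%N]) (drifted (s j) @^-1` C j) by [].
  apply: bigcap_measurable => [|j _]; first by exists 0%N.
  by rewrite -[_ @^-1` _]setTI; exact: measurable_drifted.
pose sh c : measurableTypeR R -> measurableTypeR R := fun x => 1 * x + c.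
have msh c A : measurable A -> measurable (sh c @^-1` A).
  by move=> mA; rewrite -[_ @^-1` _]setTI; exact: measurable_affine.
have -> : drifted_increment (s k) t @^-1` B =
    (W t \- W (s k)) @^-1` (sh (mu * (t - s k)) @^-1` B).
  by apply/seteqP; split=> w; rewrite /sh/= mul1r.
have -> : E = [set w | forall j, (j <= k)%N ->
    (sh (mu * s j) @^-1` C j) (W (s j) w - W (s 0%N) w)].
  by apply/seteqP; split=> w H j jk; have := H j jk; rewrite /sh/= mul1r s0.
have s00 : 0 <= s 0%N by rewrite s0.
exact: (brownian_past_independent bW s00 s_nd skt
  (fun j => msh (mu * s j) _ (mC j)) (msh (mu * (t - s k)) _ mB)).
Qed.

Lemma drifted_continuous : {ae P, forall w,
  forall t, {within `[0, t], continuous (fun s => drifted s w)}}.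
Proof.
have [N [mN N0 sN]] := bm_continuous_paths bW.
exists N; split=> // w nw; apply: sN => cw; apply: nw => t {N mN N0}.
have cW : {within `[0, t], continuous (fun s => W s w)}.
  by apply: continuous_subspaceW cw => x /=; rewrite !in_itv/= andbT => /andP[].
apply/subspace_continuousP => x xt; rewrite /drifted.
apply: (@cvgD _ R^o).
  apply: (@cvgB _ R^o); last exact: cvg_cst.
  by move/subspace_continuousP : cW; exact.
apply: cvgMl_tmp; apply: cvg_within_filter; exact: cvg_id.
Qed.

End drifted_brownian_motion.

(** * First crossing of a level on a finite grid *)

Section discrete_crossing.
Context d (T : measurableType d) (R : realType) (P : probability T R).
Variables (W : R -> {RV P >-> R}) (mu t m : R).
Hypotheses (bW : standard_brownian_motion W) (t0 : 0 < t) (m0 : 0 <= m).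

Local Notation Z := (drifted W mu).

Definition grid (n j : nat) : R := t * j%:R / n.+1%:R.

Definition grid_crossing (n : nat) : set T :=
  [set w | exists2 k, (k <= n.+1)%N & m < Z (grid n k) w].

Definition first_grid_crossing (n k : nat) : set T :=
  [set w | (forall j, (j < k)%N -> Z (grid n j) w <= m) /\ m < Z (grid n k) w].

Definition grid_oscillation (n : nat) (w : T) : R :=
  \big[Num.max/0]_(j < n.+1) `|Z (grid n j.+1) w - Z (grid n j) w|.

Lemma grid0 n : grid n 0 = 0.
Proof. by rewrite /grid mulr0 mul0r. Qed.

Lemma gridn n : grid n n.+1 = t.
Proof. by rewrite /grid mulfK. Qed.

Lemma grid_nd n : {homo grid n : i j / (i <= j)%N >-> i <= j}.
Proof.
by move=> i j ij; rewrite ler_pM2r ?invr_gt0// ler_pM2l// ler_nat.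
Qed.

Lemma grid_ge0 n k : 0 <= grid n k.
Proof. by rewrite -(grid0 n) grid_nd. Qed.

Lemma grid_le n k : (k <= n.+1)%N -> grid n k <= t.
Proof. by move=> kn; rewrite -(gridn n) grid_nd. Qed.

Lemma measurable_first_grid_crossing n k : measurable (first_grid_crossing n k).
Proof.
have -> : first_grid_crossing n k =
    \bigcap_(j in [set j | (j < k)%N]) (Z (grid n j) @^-1` `]-oo, m]) `&`
    Z (grid n k) @^-1` `]m, +oo[.
  apply/seteqP; split=> w [H mk].
    by split=> [j /= jk|]; rewrite /= in_itv/= ?H// andbT.
  split=> [j jk|]; first by have := H j jk; rewrite /= in_itv.
  by move: mk; rewrite /= in_itv/= andbT.
apply: measurableI.
  apply: bigcap_measurableType => j _.
  by rewrite -[_ @^-1` _]setTI; apply: measurable_drifted.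
by rewrite -[_ @^-1` _]setTI; apply: measurable_drifted.
Qed.

Lemma trivIset_first_grid_crossing n (D : set nat) :
  trivIset D (first_grid_crossing n).
Proof.
apply/trivIsetP => i j _ _; wlog ij : i j / (i < j)%N.
  by move=> h; rewrite neq_ltn => /orP[] ij; [|rewrite setIC]; apply: h => //;
    rewrite neq_ltn ij ?orbT.
move=> _; rewrite -subset0 => w [[_ mi] [/(_ i ij)]].
by rewrite leNgt mi.
Qed.

Lemma grid_crossingE n :
  grid_crossing n = \big[setU/set0]_(k <- iota 0 n.+2) first_grid_crossing n k.
Proof.
rewrite -bigcup_seq; apply/seteqP; split=> w; last first.
  move=> [k kin [_ mk]]; exists k => //.
  by have : k \in iota 0 n.+2 := kin; rewrite mem_iota.
case=> k kn mk; have exk : exists k, m < Z (grid n k) w by exists k.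
case: (ex_minnP exk) => j mj jmin; exists j.
  suff : j \in iota 0 n.+2 by [].
  by rewrite mem_iota add0n/= ltnS (leq_trans (jmin _ mk)).
by split=> // i ij; rewrite leNgt; apply: contraTN ij => /jmin; rewrite -leqNgt.
Qed.

Lemma measurable_grid_crossing n : measurable (grid_crossing n).
Proof.
rewrite grid_crossingE; apply: bigsetU_measurable => k _.
exact: measurable_first_grid_crossing.
Qed.

Lemma measurable_grid_oscillation n :
  measurable_fun [set: T] (grid_oscillation n).
Proof.
have mbig (k : nat) (F : nat -> T -> R) :
    (forall j, measurable_fun [set: T] (F j)) ->
    measurable_fun [set: T] (fun w => \big[Num.max/0]_(j < k) F j w).
  elim: k F => [|k ih] F mF.
    by under eq_fun do rewrite big_ord0; exact: measurable_cst.
  under eq_fun do rewrite big_ord_recl.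
  apply: measurable_maxr; first exact: mF.
  exact: (ih (fun j => F j.+1)).
apply: (mbig n.+1 (fun j w => `|Z (grid n j.+1) w - Z (grid n j) w|)) => j.
by apply: measurableT_comp => //; apply: measurable_funB; exact: measurable_drifted.
Qed.

Lemma grid_oscillation_ge0 n w : 0 <= grid_oscillation n w.
Proof. exact: bigmax_ge_id. Qed.

(** At the preceding grid time the path was still at most [m], so the overshoot is at most the last
    step. A crossing at index 0 is impossible: the path starts at 0 <= m. *)
Lemma overshoot_le n k w : first_grid_crossing n k w -> (k <= n.+1)%N ->
  `|Z (grid n k) w - m| <= grid_oscillation n w.
Proof.
case=> Hj mk; case: k Hj mk => [|k] Hj mk kn.
  by move: mk; rewrite grid0 drifted0 ltNge m0.
rewrite gtr0_norm ?subr_gt0//.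
apply: (@le_trans _ _ `|Z (grid n k.+1) w - Z (grid n k) w|).
  rewrite (le_trans _ (ler_norm _))// lerD2l lerN2; exact: Hj.
exact: (le_bigmax _ _ (Ordinal kn)).
Qed.

Variables (p q : R -> R) (C L : R).
Hypotheses (mp : measurable_fun [set: R] p) (mq : measurable_fun [set: R] q).
Hypotheses (p_bnd : forall x, 0 <= p x <= C) (q_ge0 : forall x, 0 <= q x).
Hypotheses (p_lip : forall x y, `|p x - p y| <= L * `|x - y|)
           (q_lip : forall x y, `|q x - q y| <= L * `|x - y|).
Hypothesis pq0 : p 0 = q 0.
Hypothesis pqE : forall r, 0 < r ->
  (\int[normal_prob (mu * r) (Num.sqrt r)]_x (p x)%:E =
   \int[normal_prob (mu * r) (Num.sqrt r)]_x (q x)%:E)%E.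

(** The event of a first crossing at index [k], even intersected with a condition on the position at
    that time, depends only on grid positions up to [k]; it is thus independent of the remaining
    increment, and [stopped_integral_le] applies. *)
Lemma first_grid_crossing_integral_le n k : (k <= n.+1)%N ->
  (\int[P]_(w in first_grid_crossing n k) (p (Z t w - m))%:E <=
   \int[P]_(w in first_grid_crossing n k) (q (Z t w - m))%:E +
   \int[P]_(w in first_grid_crossing n k)
      (Num.min C (2 * L * grid_oscillation n w))%:E)%E.
Proof.
move=> kn; set E := first_grid_crossing n k.
have mE : measurable E by exact: measurable_first_grid_crossing.
have L0 : 0 <= L by have := p_lip 1 0; rewrite subr0 normr1 mulr1; exact: le_trans.
have C0 : 0 <= C by have /andP[] := p_bnd 0; exact: le_trans.
pose U := mfun_of (@measurable_drifted _ _ _ _ W mu (grid n k)).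
pose Y := mfun_of (@measurable_drifted_increment _ _ _ _ W mu (grid n k) t).
have ind A B : measurable A -> measurable B ->
    P (E `&` U @^-1` A `&` Y @^-1` B) = (P (E `&` U @^-1` A) * P (Y @^-1` B))%E.
  move=> mA mB.
  pose D j : set R := if (j < k)%N then `]-oo, m]%classic
                      else `]m, +oo[%classic `&` A.
  have -> : E `&` U @^-1` A = [set w | forall j, (j <= k)%N -> D j (Z (grid n j) w)].
    apply/seteqP; split=> w.
      move=> [[Hj mk] Aw] j; rewrite leq_eqVlt => /orP[/eqP ->|jk].
        by rewrite /D ltnn; split=> //=; rewrite in_itv/= mk.
      by rewrite /D jk /= in_itv/= Hj.
    move=> H; split; last by have := H k (leqnn k); rewrite /D ltnn => -[].
    split=> [j jk|]; first by have := H j (ltnW jk); rewrite /D jk/= in_itv.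
    by have := H k (leqnn k); rewrite /D ltnn => -[] /=; rewrite in_itv/= andbT.
  have mD j : measurable (D j) by rewrite /D; case: ifP => // _; exact: measurableI.
  by have [] := drifted_past_independent mu bW (grid0 n) (@grid_nd n) (grid_le kn) mD mB.
have pqY : (\int[distribution P Y]_x (p x)%:E = \int[distribution P Y]_x (q x)%:E)%E.
  have p_ge0 x : 0 <= p x by case/andP: (p_bnd x).
  rewrite !ge0_integral_distribution//; try exact/measurable_EFinP.
  have [kt|] := ltP (grid n k) t.
    transitivity (\int[normal_prob (mu * (t - grid n k))
        (Num.sqrt (t - grid n k))]_x (p x)%:E)%E.
      rewrite -(drifted_increment_integral mu bW)//; first exact: grid_ge0.
      exact/measurable_EFinP.
    rewrite pqE ?subr_gt0//.
    rewrite -(drifted_increment_integral mu bW)//; first exact: grid_ge0.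
    exact/measurable_EFinP.
  (* At the last grid time the remaining increment is 0, and the balance reduces to [p 0 = q 0]. *)
  move=> tk; have kt : grid n k = t by apply/eqP; rewrite eq_le tk grid_le.
  apply: eq_integral => w _ /=.
  by rewrite /Y/= /drifted_increment kt !subrr mulr0 addr0 pq0.
have := @stopped_integral_le _ _ _ P U Y E p q C L m mE ind
  mp mq p_bnd q_ge0 p_lip q_lip pqY.
have UY f : (\int[P]_(w in E) (f (U w + Y w - m))%:E =
    \int[P]_(w in E) (f (Z t w - m))%:E)%E.
  by apply: eq_integral => w _; rewrite /U /Y/= driftedD.
rewrite !UY => /le_trans; apply; apply: leeD => //.
apply: ge0_le_integral => //.
- by move=> w _; rewrite lee_fin le_min C0 !mulr_ge0.
- apply: measurable_funTS; apply/measurable_EFinP; apply: measurable_minr => //.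
  apply: measurable_funM => //; apply: measurableT_comp => //.
  by apply: measurable_funB => //; exact: measurable_drifted.
- apply: measurable_funTS; apply/measurable_EFinP; apply: measurable_minr => //.
  by apply: measurable_funM => //; exact: measurable_grid_oscillation.
- move=> w Ew; rewrite lee_fin; apply: le_min2 => //.
  by rewrite ler_wpM2l ?mulr_ge0//; exact: overshoot_le.
Qed.

(** The first crossing events are disjoint, so the error terms add up to one integral over the
    crossing event, which is then enlarged to the whole space. *)
Lemma grid_crossing_integral_le n :
  (\int[P]_(w in grid_crossing n) (p (Z t w - m))%:E <=
   \int[P]_(w in grid_crossing n) (q (Z t w - m))%:E +
   \int[P]_w (Num.min C (2 * L * grid_oscillation n w))%:E)%E.
Proof.
have p_ge0 x : 0 <= p x by case/andP: (p_bnd x).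
have L0 : 0 <= L by have := p_lip 1 0; rewrite subr0 normr1 mulr1; exact: le_trans.
have C0 : 0 <= C by have /andP[] := p_bnd 0; exact: le_trans.
have mZ (f : R -> R) : measurable_fun [set: R] f ->
    measurable_fun [set: T] (fun w => (f (Z t w - m))%:E).
  move=> mf; apply/measurable_EFinP; apply: (measurableT_comp mf).
  by apply: measurable_funB => //; exact: measurable_drifted.
have mo : measurable_fun [set: T]
    (fun w => (Num.min C (2 * L * grid_oscillation n w))%:E).
  apply/measurable_EFinP; apply: measurable_minr => //.
  by apply: measurable_funM => //; exact: measurable_grid_oscillation.
have o_ge0 w : 0 <= Num.min C (2 * L * grid_oscillation n w).
  by rewrite le_min C0 !mulr_ge0// grid_oscillation_ge0.
apply: (@le_trans _ _ (\int[P]_(w in grid_crossing n) (q (Z t w - m))%:E +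
   \int[P]_(w in grid_crossing n)
     (Num.min C (2 * L * grid_oscillation n w))%:E)%E); last first.
  apply: leeD => //; apply: ge0_subset_integral => //.
    exact: measurable_grid_crossing.
  by move=> w _; rewrite lee_fin.
have split_int (f : T -> R) : measurable_fun [set: T] (EFin \o f) ->
    (forall w, 0 <= f w) ->
    (\int[P]_(w in grid_crossing n) (f w)%:E =
     \sum_(k <- iota 0 n.+2) \int[P]_(w in first_grid_crossing n k) (f w)%:E)%E.
  move=> mf f0; rewrite grid_crossingE ge0_integral_bigsetU//.
  - by move=> k; exact: measurable_first_grid_crossing.
  - exact: iota_uniq.
  - exact: trivIset_first_grid_crossing.
  - exact: measurable_funTS.
  - by move=> w _; rewrite lee_fin.
rewrite !split_int//; try exact: mZ.
rewrite -big_split big_seq [leRHS]big_seq; apply: lee_sum => k kin.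
have kn : (k <= n.+1)%N.
  by have : k \in iota 0 n.+2 := kin; rewrite mem_iota.
exact: first_grid_crossing_integral_le.
Qed.

End discrete_crossing.

(** * Passing to the limit in the mesh *)

Section crossing_limit.
Context d (T : measurableType d) (R : realType) (P : probability T R).
Variables (W : R -> {RV P >-> R}) (mu t m : R) (M : T -> R).
Hypotheses (bW : standard_brownian_motion W) (t0 : 0 < t) (m0 : 0 <= m).
Hypothesis mM : measurable_fun [set: T] M.

Local Notation Z := (drifted W mu).

Hypothesis hM : {ae P, forall w,
  [set Z s w | s in `[0, t]] (M w) /\ ubound [set Z s w | s in `[0, t]] (M w)}.

Lemma measurable_level A : measurable A -> measurable (M @^-1` A).
Proof. by move=> mA; rewrite -[_ @^-1` _]setTI; exact: mM. Qed.

(** If M <= m, no grid point exceeds [m]. If M > m, the maximum is attained at some time, and fine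
    grids have a point near it that exceeds [m]. *)
Lemma grid_crossing_indic_cvg : {ae P, forall w,
  \forall n \near \oo, \1_(grid_crossing W mu t m n) w =
    \1_(M @^-1` `]m, +oo[) w :> R}.
Proof.
have [N1 [mN1 N10 sN1]] := hM.
have [N2 [mN2 N20 sN2]] := drifted_continuous mu bW.
exists (N1 `|` N2); split.
- exact: measurableU.
- by rewrite null_set_setU.
- move=> w /= nw; apply: contrapT => /not_orP[n1 n2]; apply: nw.
  have [[s st MZ] uM] : [set Z s w | s in `[0, t]] (M w) /\
      ubound [set Z s w | s in `[0, t]] (M w).
    by apply: contrapT => h; apply: n1; exact: sN1.
  have cZ : forall t, {within `[0, t], continuous (fun s => Z s w)}.
    by apply: contrapT => h; apply: n2; exact: sN2.
  rewrite /= in_itv/= in st.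
  have crossM n : grid_crossing W mu t m n w -> m < M w.
    move=> [k kn mk]; apply: lt_le_trans mk _; apply: uM.
    by exists (grid t n k) => //=; rewrite in_itv/= grid_ge0// grid_le.
  have [Mm|mM'] := leP (M w) m.
    apply: nearW => n; rewrite !indicE; congr (nat_of_bool _)%:R.
    apply/idP/idP => /set_mem; first by move=> /crossM; rewrite ltNge Mm.
    by rewrite /= in_itv/= andbT ltNge Mm.
  have ms : m < Z s w by rewrite MZ.
  have := grid_exceeds t0 (cZ t) st ms; apply: filterS => n [k kn mk].
  rewrite !indicE; congr (nat_of_bool _)%:R.
  apply/idP/idP => _; apply/mem_set; first by rewrite /= in_itv/= mM'.
  by exists k.
Qed.

Lemma grid_oscillation_ae_cvg0 : {ae P, forall w,
  grid_oscillation W mu t n w @[n --> \oo] --> (0 : R)}.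
Proof.
have [N [mN N0 sN]] := drifted_continuous mu bW.
exists N; split=> // w nw; apply: sN => cZ; apply: nw => /=.
apply/cvgrPdist_lt => e e0.
have := grid_oscillation_cvg0 t0 (cZ t) e0; apply: filterS => n He.
rewrite sub0r normrN ger0_norm; last exact: grid_oscillation_ge0.
apply/bigmax_ltP; split=> // j _.
by apply: He; rewrite -ltnS.
Qed.

Lemma grid_crossing_integral_cvg (f : R -> R) (C : R) :
  measurable_fun [set: R] f -> (forall x, 0 <= f x <= C) ->
  (\int[P]_(w in grid_crossing W mu t m n) (f (Z t w - m))%:E @[n --> \oo] -->
   \int[P]_(w in M @^-1` `]m, +oo[) (f (Z t w - m))%:E)%E.
Proof.
move=> mf fC.
have mZ : measurable_fun [set: T] (fun w => f (Z t w - m)).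
  apply: (measurableT_comp mf).
  by apply: measurable_funB => //; exact: measurable_drifted.
have intE A : measurable A -> (\int[P]_(w in A) (f (Z t w - m))%:E =
    \int[P]_w (f (Z t w - m) * \1_A w)%:E)%E.
  move=> mA; rewrite integral_mkcond; apply: eq_integral => w _.
  by rewrite patchE indicE; case: ifP => _; rewrite ?mulr1 ?mulr0.
have mA n : measurable (grid_crossing W mu t m n).
  exact: measurable_grid_crossing.
have mMm : measurable (M @^-1` `]m, +oo[) by exact: measurable_level.
under eq_fun do rewrite intE//.
rewrite intE//.
have [] := @dominated_convergence _ _ _ P setT measurableT
  (fun n w => (f (Z t w - m) * \1_(grid_crossing W mu t m n) w)%:E)
  (fun w => (f (Z t w - m) * \1_(M @^-1` `]m, +oo[) w)%:E)
  (cst C%:E) => //.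
- by move=> n; apply/measurable_EFinP; exact: measurable_funM.
- by apply/measurable_EFinP; exact: measurable_funM.
- have [N [mN N0 sN]] := grid_crossing_indic_cvg.
  exists N; split=> // w nw; apply: sN => H; apply: nw => _.
  apply: cvg_near_cst; apply: filterS H => n ->//.
- exact: finite_measure_integrable_cst.
- apply: aeW => w n _; have /andP[f0 fC'] := fC (Z t w - m).
  rewrite lee_fin normrM ger0_norm// indicE.
  by case: (_ \in _); rewrite ?normr1 ?normr0 ?mulr1 ?mulr0// (le_trans f0).
Qed.

Variables (p q : R -> R) (C L : R).
Hypotheses (mp : measurable_fun [set: R] p) (mq : measurable_fun [set: R] q).
Hypotheses (p_bnd : forall x, 0 <= p x <= C) (q_bnd : forall x, 0 <= q x <= C).
Hypotheses (p_lip : forall x y, `|p x - p y| <= L * `|x - y|)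
           (q_lip : forall x y, `|q x - q y| <= L * `|x - y|).
Hypothesis pq0 : p 0 = q 0.
Hypothesis pqE : forall r, 0 < r ->
  (\int[normal_prob (mu * r) (Num.sqrt r)]_x (p x)%:E =
   \int[normal_prob (mu * r) (Num.sqrt r)]_x (q x)%:E)%E.

(** The oscillation over one step vanishes almost surely by continuity, and the truncation at [C]
    lets dominated convergence remove the error term. The hypotheses are symmetric in [p] and [q],
    so exchanging them gives the converse inequality. *)
Lemma crossing_integral_le :
  (\int[P]_(w in M @^-1` `]m, +oo[) (p (Z t w - m))%:E <=
   \int[P]_(w in M @^-1` `]m, +oo[) (q (Z t w - m))%:E)%E.
Proof.
have L0 : 0 <= L by have := p_lip 1 0; rewrite subr0 normr1 mulr1; exact: le_trans.
have C0 : 0 <= C by have /andP[] := p_bnd 0; exact: le_trans.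
have q_ge0 x : 0 <= q x by case/andP: (q_bnd x).
have cp := grid_crossing_integral_cvg mp p_bnd.
have cq := grid_crossing_integral_cvg mq q_bnd.
have o0 n w : 0 <= 2 * L * grid_oscillation W mu t n w.
  by rewrite !mulr_ge0// grid_oscillation_ge0.
have [] := @dominated_convergence _ _ _ P setT measurableT
  (fun n w => (Num.min C (2 * L * grid_oscillation W mu t n w))%:E)
  (cst 0%E) (cst C%:E) => //.
- move=> n; apply/measurable_EFinP; apply: measurable_minr => //.
  by apply: measurable_funM => //; exact: measurable_grid_oscillation.
- have [N [mN N0 sN]] := grid_oscillation_ae_cvg0.
  exists N; split=> // w nw; apply: sN => H; apply: nw => _.
  apply: cvg_EFin; first exact: nearW.
  apply: (@squeeze_cvgr _ _ _ _ (cst 0)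
      (fun n => 2 * L * grid_oscillation W mu t n w)).
  + by apply: nearW => n; rewrite /= le_min C0 o0/= ge_min lexx orbT.
  + exact: cvg_cst.
  + by rewrite -[X in _ --> X](mulr0 (2 * L)); exact: cvgMl_tmp.
- exact: finite_measure_integrable_cst.
- apply: aeW => w n _; rewrite lee_fin ger0_norm ?le_min ?C0 ?o0//.
  by rewrite ge_min lexx.
rewrite integral0 => _ _ co.
have cqo := @cvgeD _ \oo (@filter_filter _ _ eventually_filter) R _ _ _ _
  (fin_num_adde_defl _ (isT : 0%E \is a fin_num)) cq co.
rewrite -(cvg_lim _ cp)// -[leRHS]adde0 -(cvg_lim _ cqo)//.
apply: lee_lim.
- by apply/cvg_ex; eexists; exact: cp.
- by apply/cvg_ex; eexists; exact: cqo.
- by apply: nearW => n; exact: grid_crossing_integral_le.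
Qed.

End crossing_limit.

(** * Reflection with drift *)

Section trapezoid.
Context {R : realType}.
Implicit Types (b z : R) (n : nat).

(** It rises with slope 1 from - (n + 2) to - (n + 1) and falls with slope n + 1 from [b] to b + 1 /
    (n + 1), as soon as - (n + 1) <= b. The falling side approximates the indicator of z <= b; the
    rising side cuts off the region where the reflected exponential weight is large. *)
Definition trapezoid b n z : R :=
  Num.max 0 (Num.min 1 (Num.min (n.+1%:R * (b - z) + 1) (z + n.+2%:R))).

Lemma trapezoid_bnd b n z : 0 <= trapezoid b n z <= 1.
Proof. by rewrite /trapezoid le_max lexx/= ge_max ler01/= ge_min lexx. Qed.

Lemma measurable_trapezoid b n : measurable_fun [set: R] (trapezoid b n).
Proof.
apply: measurable_maxr => //; apply: measurable_minr => //.
apply: measurable_minr; last exact: measurable_funD.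
by apply: measurable_funD => //; apply: measurable_funM => //; exact: measurable_funB.
Qed.

Lemma ler_dist_max (a x y : R) : `|Num.max a x - Num.max a y| <= `|x - y|.
Proof.
have := ler_norm (x - y); have := ler_norm (y - x); rewrite distrC ler_norml.
by case: (leP a x) => ?; case: (leP a y) => ?; lra.
Qed.

Lemma ler_dist_min (a x y : R) : `|Num.min a x - Num.min a y| <= `|x - y|.
Proof.
have := ler_norm (x - y); have := ler_norm (y - x); rewrite distrC ler_norml.
by case: (leP a x) => ?; case: (leP a y) => ?; lra.
Qed.

Lemma ler_dist_min2 (k x y x' y' : R) : `|x - x'| <= k -> `|y - y'| <= k ->
  `|Num.min x y - Num.min x' y'| <= k.
Proof.
rewrite !ler_norml => /andP[? ?] /andP[? ?].
by case: (leP x y) => ?; case: (leP x' y') => ?; lra.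
Qed.

Lemma trapezoid_lip b n x y :
  `|trapezoid b n x - trapezoid b n y| <= n.+1%:R * `|x - y|.
Proof.
apply: le_trans (ler_dist_max _ _ _) _; apply: le_trans (ler_dist_min _ _ _) _.
apply: ler_dist_min2.
  have -> : n.+1%:R * (b - x) + 1 - (n.+1%:R * (b - y) + 1) = n.+1%:R * (y - x).
    by ring.
  by rewrite normrM ger0_norm// distrC.
have -> : x + n.+2%:R - (y + n.+2%:R) = x - y by ring.
by rewrite ler_peMl// ler1n.
Qed.

Lemma trapezoid_eq1 b n z : z <= b -> - n.+1%:R <= z -> trapezoid b n z = 1.
Proof.
move=> zb nz; rewrite /trapezoid (min_l (y := Num.min _ _)) ?max_r//.
rewrite le_min; apply/andP; split.
  by rewrite lerDr mulr_ge0// subr_ge0.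
by rewrite -[n.+2%:R]natr1 addrA lerDr addrC -lerBlDl sub0r.
Qed.

Lemma trapezoid_eq0r b n z : b + n.+1%:R^-1 <= z -> trapezoid b n z = 0.
Proof.
move=> bz; apply: max_l; rewrite !ge_min.
have : n.+1%:R * (b + n.+1%:R^-1) <= n.+1%:R * z :> R by rewrite ler_pM2l.
rewrite mulrDr mulfV// => h; apply/orP; right; apply/orP; left.
by rewrite mulrBr; lra.
Qed.

Lemma trapezoid_eq0l b n z : z <= - n.+2%:R -> trapezoid b n z = 0.
Proof.
move=> zn; apply: max_l; rewrite !ge_min; apply/orP; right; apply/orP; right.
by rewrite -lerBrDr sub0r.
Qed.

Lemma trapezoid_cvg b z : \forall n \near \oo,
  trapezoid b n z = \1_(`]-oo, b]%classic : set R) z.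
Proof.
have [zb|bz] := leP z b.
  have := nbhs_infty_gtr (- z); apply: filterS => n nz.
  rewrite indicE mem_set/= ?in_itv// trapezoid_eq1//.
  by rewrite lerNl (le_trans (ltW nz))// ler_nat.
have := nbhs_infty_gtr ((z - b)^-1); apply: filterS => n nz.
rewrite indicE memNset/= ?in_itv/=; last by apply/negP; rewrite -ltNge.
apply: trapezoid_eq0r; rewrite -lerBrDl.
rewrite -[leRHS]invrK lef_pV2 ?posrE ?invr_gt0 ?subr_gt0//.
by rewrite (le_trans (ltW nz))// ler_nat.
Qed.

(** Convexity suffices: the tangent bound exp (x - y) >= 1 + (x - y), multiplied by exp y, bounds
    the difference for x <= y. *)
Lemma expR_lip (K x y : R) : x <= K -> y <= K ->
  `|expR x - expR y| <= expR K * `|x - y|.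
Proof.
wlog xy : x y / x <= y.
  move=> h xK yK; have [xy|/ltW yx] := leP x y; first exact: h.
  by rewrite distrC (distrC x); exact: h.
move=> xK yK; rewrite ler0_norm ?subr_le0 ?ler_expR//.
rewrite ler0_norm ?subr_le0// !opprB.
have h := expR_ge1Dx (x - y).
have : expR y * (1 + (x - y)) <= expR x.
  have -> : expR x = expR y * expR (x - y) by rewrite -expRD addrC subrK.
  by rewrite ler_pM2l ?expR_gt0.
have : expR y * (y - x) <= expR K * (y - x).
  by rewrite ler_wpM2r ?subr_ge0// ler_expR.
nra.
Qed.

Variable mu : R.

Definition clamp (K z : R) : R := Num.max (- K) (Num.min K z).

(* For [b < 0] the clamping changes no value, see [reflected_trapezoidE], but it
   makes the function bounded and Lipschitz. *)
Definition reflected_trapezoid b n z : R :=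
  expR (- 2 * mu * clamp n.+2%:R z) * trapezoid b n (- z).

Let bound n : R := expR (2 * `|mu| * n.+2%:R).

Let exponent_le n z : - 2 * mu * clamp n.+2%:R z <= 2 * `|mu| * n.+2%:R.
Proof.
have cl : `|clamp n.+2%:R z| <= n.+2%:R.
  have n0 : 0 <= n.+2%:R :> R by [].
  rewrite ler_norml /clamp le_max lexx/= ge_max ge_min lexx/= andbT.
  by rewrite (le_trans _ n0)// oppr_le0.
rewrite -!mulrA mulNr (le_trans (ler_norm _))// normrN normrM ger0_norm//.
by rewrite ler_pM2l// normrM ler_wpM2l.
Qed.

(** Clamping acts only for |z| > n + 2, where the trapezoid at - z is 0: beyond its left end if z is
    positive, and beyond its right end b + 1 / (n + 1) < 1 if z is negative. *)
Lemma reflected_trapezoidE b n z : b < 0 ->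
  reflected_trapezoid b n z = expR (- 2 * mu * z) * trapezoid b n (- z).
Proof.
move=> b0; rewrite /reflected_trapezoid.
have [zn|nz] := leP z (- n.+2%:R).
  rewrite trapezoid_eq0r ?mulr0//.
  apply: (@le_trans _ _ n.+1%:R^-1); first by rewrite gerDr ltW.
  apply: (@le_trans _ _ 1); first by rewrite invf_le1// ler1n.
  by rewrite lerNr (le_trans zn)// lerN2 ler1n.
have [nz'|zn] := leP n.+2%:R z.
  by rewrite trapezoid_eq0l ?mulr0// lerN2.
by rewrite /clamp (min_r (ltW zn)) max_r// ltW.
Qed.

Lemma reflected_trapezoid_bnd b n z :
  0 <= reflected_trapezoid b n z <= expR (2 * `|mu| * n.+2%:R).
Proof.
have /andP[t0 t1] := trapezoid_bnd b n (- z).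
rewrite mulr_ge0 ?expR_ge0//=.
rewrite -[leRHS]mulr1 ler_pM ?expR_ge0// ler_expR.
exact: exponent_le.
Qed.

Lemma measurable_reflected_trapezoid b n :
  measurable_fun [set: R] (reflected_trapezoid b n).
Proof.
apply: measurable_funM.
  apply: measurableT_comp => //; apply: measurable_funM => //.
  by apply: measurable_maxr => //; exact: measurable_minr.
by apply: measurableT_comp => //; exact: measurable_trapezoid.
Qed.

(** Product rule for Lipschitz constants: [bound n] dominates the exponential, 2 |mu| is the slope
    of its exponent, and n + 1 is the Lipschitz constant of the trapezoid. *)
Lemma reflected_trapezoid_lip b n x y :
  `|reflected_trapezoid b n x - reflected_trapezoid b n y| <=
  (bound n * (2 * `|mu| + n.+1%:R)) * `|x - y|.
Proof.
rewrite /reflected_trapezoid.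
set ex := - 2 * mu * clamp _ x; set ey := - 2 * mu * clamp _ y.
have b0 : 0 < bound n by exact: expR_gt0.
have -> : expR ex * trapezoid b n (- x) - expR ey * trapezoid b n (- y) =
    (expR ex - expR ey) * trapezoid b n (- x) +
    expR ey * (trapezoid b n (- x) - trapezoid b n (- y)) by ring.
rewrite [X in _ <= X * _]mulrDr [leRHS]mulrDl; apply: le_trans (ler_normD _ _) _; apply: lerD.
  rewrite normrM; have /andP[t0 t1] := trapezoid_bnd b n (- x).
  rewrite (ger0_norm t0) -[leRHS]mulr1 ler_pM//.
  apply: le_trans (expR_lip (exponent_le _ _) (exponent_le _ _)) _.
  rewrite -[leRHS]mulrA ler_pM2l// -mulrBr normrM normrM normrN.
  rewrite (ger0_norm (ler0n _ 2)) ler_wpM2l ?mulr_ge0//.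
  by apply: le_trans (ler_dist_max _ _ _) _; exact: ler_dist_min.
rewrite normrM ger0_norm ?expR_ge0// -mulrA ler_pM ?expR_ge0//.
  by rewrite ler_expR; exact: exponent_le.
apply: le_trans (trapezoid_lip _ _ _ _) _.
by rewrite -opprD normrN.
Qed.

End trapezoid.

Lemma trapezoid_integral_cvg d (T : measurableType d) (R : realType)
    (P : probability T R) (A : set T) (X : T -> R) (b : R) :
  measurable A -> measurable_fun [set: T] X ->
  (\int[P]_(w in A) (trapezoid b n (X w))%:E @[n --> \oo] -->
   P (A `&` X @^-1` `]-oo, b]))%E.
Proof.
move=> mA mX.
have mXb : measurable (X @^-1` `]-oo, b]) by rewrite -[_ @^-1` _]setTI; exact: mX.
have [] := @dominated_convergence _ _ _ P A mA
  (fun n w => (trapezoid b n (X w))%:E)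
  (fun w => (\1_(X @^-1` `]-oo, b]) w)%:E) (cst 1%E).
- move=> n; apply: measurable_funTS; apply/measurable_EFinP.
  by apply: measurableT_comp => //; exact: measurable_trapezoid.
- by apply: measurable_funTS; apply/measurable_EFinP.
- apply: aeW => w _; apply: cvg_near_cst.
  by have := trapezoid_cvg b (X w); apply: filterS => n ->.
- apply: (integrableS measurableT) => //.
  exact: finite_measure_integrable_cst.
- apply: aeW => w n _; have /andP[t0 t1] := trapezoid_bnd b n (X w).
  by rewrite lee_fin ger0_norm.
- by move=> _ _; rewrite integral_indic// setIC.
Qed.

(** * The reflection identity for the crossing event *)

Section crossing_formula.
Context d (T : measurableType d) (R : realType) (P : probability T R).
Variables (W : R -> {RV P >-> R}) (mu t m : R) (M : T -> R).
Hypotheses (bW : standard_brownian_motion W) (t0 : 0 < t) (m0 : 0 <= m).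
Hypothesis mM : measurable_fun [set: T] M.

Local Notation Z := (drifted W mu).

Hypothesis hM : {ae P, forall w,
  [set Z s w | s in `[0, t]] (M w) /\ ubound [set Z s w | s in `[0, t]] (M w)}.

Lemma drifted_integral (f : R -> R) :
  measurable_fun [set: R] f -> (forall x, 0 <= f x) ->
  (\int[P]_w (f (Z t w))%:E =
   \int[normal_prob (mu * t) (Num.sqrt t)]_x (f x)%:E)%E.
Proof.
move=> mf f0.
have := @drifted_increment_integral _ _ _ P W mu bW 0 t (EFin \o f) (lexx 0) t0.
rewrite subr0 => <-//; last exact/measurable_EFinP.
apply: eq_integral => w _ /=.
by rewrite /drifted /drifted_increment subr0.
Qed.

(** This is [normal_prob_reflect] for the trapezoid evaluated at - x; b < 0 removes the clamping. *)
Lemma trapezoid_balance b n r : b < 0 -> 0 < r ->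
  (\int[normal_prob (mu * r) (Num.sqrt r)]_x (trapezoid b n x)%:E =
   \int[normal_prob (mu * r) (Num.sqrt r)]_x
     (reflected_trapezoid mu b n x)%:E)%E.
Proof.
move=> b0 r0.
have := @normal_prob_reflect R mu (Num.sqrt r) (fun x => trapezoid b n (- x)).
rewrite sqr_sqrtr ?ltW// => H.
under [RHS]eq_integral do rewrite reflected_trapezoidE//.
rewrite -H.
- by apply: eq_integral => x _; rewrite opprK.
- by rewrite gt_eqF// sqrtr_gt0.
- by apply: measurableT_comp => //; exact: measurable_trapezoid.
- by move=> x; case/andP: (trapezoid_bnd b n (- x)).
Qed.

Lemma crossing_trapezoid_integral b n : b < 0 ->
  (\int[P]_(w in M @^-1` `]m, +oo[) (trapezoid b n (Z t w - m))%:E =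
   \int[P]_(w in M @^-1` `]m, +oo[) (reflected_trapezoid mu b n (Z t w - m))%:E)%E.
Proof.
move=> b0; pose C : R := expR (2 * `|mu| * n.+2%:R).
(* [C] and [L] serve both functions, so that the one-sided inequality can be applied in both
   directions. *)
pose L := n.+1%:R + C * (2 * `|mu| + n.+1%:R).
have C1 : 1 <= C by rewrite -expR0 ler_expR !mulr_ge0.
have p_bnd x : 0 <= trapezoid b n x <= C.
  by have /andP[-> t1] := trapezoid_bnd b n x; rewrite (le_trans t1).
have q_bnd := @reflected_trapezoid_bnd R mu b n.
have LL : 0 <= C * (2 * `|mu| + n.+1%:R).
  by rewrite mulr_ge0 ?addr_ge0 ?mulr_ge0// (le_trans _ C1).
have p_lip x y : `|trapezoid b n x - trapezoid b n y| <= L * `|x - y|.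
  by apply: le_trans (trapezoid_lip _ _ _ _) _; rewrite ler_wpM2r// lerDl.
have q_lip x y : `|reflected_trapezoid mu b n x - reflected_trapezoid mu b n y|
    <= L * `|x - y|.
  by apply: le_trans (reflected_trapezoid_lip _ _ _ _ _) _; rewrite ler_wpM2r// lerDr.
have pq0 : trapezoid b n 0 = reflected_trapezoid mu b n 0.
  by rewrite reflected_trapezoidE// mulr0 expR0 mul1r oppr0.
have mp := @measurable_trapezoid R b n.
have mq := @measurable_reflected_trapezoid R mu b n.
apply/eqP; rewrite eq_le; apply/andP; split.
  apply: (crossing_integral_le bW t0 m0 mM hM mp mq p_bnd q_bnd p_lip q_lip pq0).
  by move=> r r0; exact: trapezoid_balance.
apply: (crossing_integral_le bW t0 m0 mM hM mq mp q_bnd p_bnd q_lip p_lip).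
  exact/esym.
by move=> r r0; apply/esym; exact: trapezoid_balance.
Qed.

Lemma max_ge_drifted : {ae P, forall w, Z t w <= M w}.
Proof.
have [N [mN N0 sN]] := hM.
exists N; split=> // w nw; apply: sN => -[_ uM]; apply: nw.
by apply: uM; exists t => //=; rewrite in_itv/= lexx ltW.
Qed.

(** By the hypothesis on [b] the integrand vanishes unless Z_t > m, which forces M > m almost
    surely, so the integral extends to the whole space. There exp (- 2 mu (x - m)) splits into the
    factor exp (2 mu m) and the weight that reflects the normal law back. *)
Lemma reflected_trapezoid_integral b n : b + n.+1%:R^-1 <= 0 ->
  (\int[P]_(w in M @^-1` `]m, +oo[) (reflected_trapezoid mu b n (Z t w - m))%:E =
   (expR (2 * mu * m))%:E * \int[P]_w (trapezoid b n (Z t w + m))%:E)%E.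
Proof.
move=> bn; have b0 : b < 0 by rewrite (lt_le_trans _ bn)// ltrDl invr_gt0.
have tr0 x : 0 <= trapezoid b n x by case/andP: (trapezoid_bnd b n x).
have mZ : measurable_fun [set: T] (fun w => reflected_trapezoid mu b n (Z t w - m)).
  apply: (measurableT_comp (measurable_reflected_trapezoid _ _ _)).
  by apply: measurable_funB => //; exact: measurable_drifted.
have mMm : measurable (M @^-1` `]m, +oo[).
  by rewrite -[_ @^-1` _]setTI; exact: mM.
rewrite integral_mkcond.
transitivity (\int[P]_w (reflected_trapezoid mu b n (Z t w - m))%:E)%E.
  apply: ae_eq_integral => //.
  - apply/(measurable_restrictT _ _).1; first exact: mMm.
    by apply: measurable_funTS; apply/measurable_EFinP; exact: mZ.
  - by apply/measurable_EFinP; exact: mZ.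
  - have [N [mN N0 sN]] := max_ge_drifted.
    exists N; split=> // w nw; apply: sN => ZM; apply: nw => _.
    rewrite patchE; case: ifPn => // /negP wM.
    rewrite reflected_trapezoidE// trapezoid_eq0r ?mulr0// (le_trans bn)//.
    rewrite oppr_ge0 subr_le0 leNgt; apply/negP => mZt; apply: wM.
    by rewrite inE /= in_itv/= (lt_le_trans mZt).
pose f x := reflected_trapezoid mu b n (x - m).
have mf : measurable_fun [set: R] f.
  apply: (measurableT_comp (measurable_reflected_trapezoid _ _ _)).
  exact: measurable_funB.
have f0 x : 0 <= f x by case/andP: (reflected_trapezoid_bnd mu b n (x - m)).
pose g x := trapezoid b n (m - x).
have mg : measurable_fun [set: R] g.
  apply: (measurableT_comp (measurable_trapezoid _ _)).
  exact: measurable_funB.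
pose h x := trapezoid b n (x + m).
have mh : measurable_fun [set: R] h.
  apply: (measurableT_comp (measurable_trapezoid _ _)).
  exact: measurable_funD.
rewrite (drifted_integral mf f0) (drifted_integral mh (fun x => tr0 _)).
have s0 : Num.sqrt t != 0 by rewrite gt_eqF// sqrtr_gt0.
have := @normal_prob_reflect R mu (Num.sqrt t) g s0 mg (fun x => tr0 _).
rewrite sqr_sqrtr ?ltW// => H.
have -> : (\int[normal_prob (mu * t) (Num.sqrt t)]_x (h x)%:E =
    \int[normal_prob (mu * t) (Num.sqrt t)]_x (g (- x))%:E)%E.
  by apply: eq_integral => x _; rewrite /g /h opprK addrC.
rewrite H -ge0_integralZl//; last 2 first.
- apply/measurable_EFinP; apply: measurable_funM => //.
  by apply: measurableT_comp => //; exact: measurable_funM.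
- by move=> x _; rewrite lee_fin mulr_ge0 ?expR_ge0 ?tr0.
apply: eq_integral => x _; rewrite /f reflected_trapezoidE// -EFinM mulrA -expRD.
by rewrite /g opprB; congr (expR _ * _)%:E; ring.
Qed.

Lemma crossing_distribution a : a < m ->
  P (M @^-1` `]m, +oo[ `&` Z t @^-1` `]-oo, a]) =
  ((expR (2 * mu * m))%:E * P (Z t @^-1` `]-oo, (a - 2 * m)%R]))%E.
Proof.
move=> am; pose b := a - m; have b0 : b < 0 by rewrite subr_lt0.
have mMm : measurable (M @^-1` `]m, +oo[).
  by rewrite -[_ @^-1` _]setTI; exact: mM.
have mZm : measurable_fun [set: T] (fun w => Z t w - m).
  by apply: measurable_funB => //; exact: measurable_drifted.
have mZp : measurable_fun [set: T] (fun w => Z t w + m).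
  by apply: measurable_funD => //; exact: measurable_drifted.
have c1 := @trapezoid_integral_cvg _ _ _ P _ _ b mMm mZm.
have c2 := @trapezoid_integral_cvg _ _ _ P _ _ b measurableT mZp.
have -> : M @^-1` `]m, +oo[ `&` Z t @^-1` `]-oo, a] =
    M @^-1` `]m, +oo[ `&` (fun w => Z t w - m) @^-1` `]-oo, b].
  by congr (_ `&` _); apply/seteqP; split=> w; rewrite /b /= !in_itv/= lerD2r.
have -> : Z t @^-1` `]-oo, (a - 2 * m)%R] =
    setT `&` (fun w => Z t w + m) @^-1` `]-oo, b].
  rewrite setTI; apply/seteqP; split=> w; rewrite /b /= !in_itv/= => ?; lra.
have c3 : ((expR (2 * mu * m))%:E * \int[P]_(w in setT) (trapezoid b n (Z t w + m))%:E
   @[n --> \oo] --> (expR (2 * mu * m))%:E *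
     P (setT `&` (fun w => Z t w + m)%R @^-1` `]-oo, b]))%E.
  exact: cvgeZl.
suff c4 : (\int[P]_(w in M @^-1` `]m, +oo[) (trapezoid b n (Z t w - m))%:E
   @[n --> \oo] --> (expR (2 * mu * m))%:E *
     P (setT `&` (fun w => Z t w + m)%R @^-1` `]-oo, b]))%E.
  exact: (cvg_unique _ c1 c4).
apply: cvg_trans c3; apply: near_eq_cvg.
(* Beyond - 1 / b the right end b + 1 / (n + 1) of the trapezoid is at most 0; this is where a < m
   is strict. *)
have := nbhs_infty_gtr (- b^-1); apply: filterS => n bn.
rewrite crossing_trapezoid_integral// reflected_trapezoid_integral//.
rewrite -lerBrDl sub0r -[leRHS]invrK lef_pV2 ?posrE ?invr_gt0 ?oppr_gt0//.
by rewrite invrN (le_trans (ltW bn))// ler_nat.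
Qed.

End crossing_formula.

(** * From the crossing identity to the joint law of maximum and terminal value *)

(** The crossing identity is known only for a < m. Continuity from below along m - 1 / (n + 1) gives
    the mass of []-oo, m[], and from [m] on both distribution functions are constant. *)
Lemma finite_measure_cdf_unique_lt (R : realType)
    (m1 m2 : {measure set R -> \bar R}) (m : R) :
  (m1 [set: R] < +oo)%E ->
  (forall a, a < m -> m1 `]-oo, a]%classic = m2 `]-oo, a]%classic) ->
  m1 `[m, +oo[%classic = 0%E -> m2 `[m, +oo[%classic = 0%E ->
  forall A, measurable A -> m1 A = m2 A.
Proof.
move=> m1fin m12 m10 m20.
pose F n : set R := `]-oo, m - n.+1%:R^-1]%classic.
have FU : \bigcup_n F n = `]-oo, m[%classic.
  apply/seteqP; split=> [x [n _]|x]; rewrite /F /= !in_itv/=.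
    by move=> /le_lt_trans; apply; rewrite ltrBlDr ltrDl invr_gt0.
  move=> /ltr_add_invr[k xk]; exists k => //=.
  by rewrite in_itv/= lerBrDr ltW.
have cF (m' : {measure set R -> \bar R}) :
    m' (F n) @[n --> \oo] --> m' `]-oo, m[%classic.
  rewrite -FU; apply: nondecreasing_cvg_mu => //.
  - by move=> n; exact: measurable_itv.
  - by apply: bigcup_measurable => n _; exact: measurable_itv.
  - move=> i j ij; apply/subsetPset; apply: subset_itvl.
    by rewrite bnd_simp lerB// lef_pV2 ?posrE// ler_nat.
have m12lt : m1 `]-oo, m[%classic = m2 `]-oo, m[%classic.
  have := cF m1; have -> : (fun n => m1 (F n)) = (fun n => m2 (F n)).
    by apply/funext => n; apply: m12; rewrite ltrBlDr ltrDl invr_gt0.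
  by move=> c1; exact: (cvg_unique _ c1 (cF m2)).
have geE (m' : {measure set R -> \bar R}) a : m <= a ->
    m' `[m, +oo[%classic = 0%E -> m' `]-oo, a]%classic = m' `]-oo, m[%classic.
  move=> ma m'0.
  have -> : `]-oo, a]%classic = `]-oo, m[ `|` `[m, a] :> set R.
    apply/seteqP; split=> x; rewrite /= !in_itv/=.
      by move=> ->; rewrite andbT; case: (ltP x m); [left|right].
    by case=> [/ltW/le_trans|/andP[]//]; exact.
  rewrite measureU//; last first.
    rewrite -subset0 => x [] /=; rewrite !in_itv/= => xm /andP[mx _].
    by move: xm; rewrite ltNge mx.
  rewrite -[RHS]adde0; congr (_ + _)%E; apply/eqP; rewrite eq_le measure_ge0 andbT.
  rewrite -m'0; apply: le_measure; rewrite ?inE//.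
  by move=> x /=; rewrite !in_itv/= andbT => /andP[].
apply: finite_measure_cdf_unique => [a|a].
  by apply: le_lt_trans m1fin; apply: le_measure; rewrite ?inE.
have [am|ma] := ltP a m; first exact: m12.
by rewrite !geE.
Qed.

Lemma measure_ae_eq d (T : measurableType d) (R : realType)
    (P : {measure set T -> \bar R}) (A B : set T) :
  measurable A -> measurable B -> {ae P, forall w, A w <-> B w} -> P A = P B.
Proof.
move=> mA mB AB.
rewrite -[A]setIT -[B]setIT -!(integral_indic P measurableT)//.
apply: ae_eq_integral => //; try by apply/measurable_EFinP.
case: AB => N [mN N0 sN]; exists N; split=> // w nw; apply: sN => AB; apply: nw => _.
congr (_%:E); rewrite !indicE; congr (nat_of_bool _)%:R.
by apply/idP/idP => /set_mem h; apply/mem_set; apply/AB.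
Qed.

Section joint_distribution.
Context d (T : measurableType d) (R : realType) (P : probability T R).
Variables (W : R -> {RV P >-> R}) (mu t t' m : R) (M : T -> R).
Hypotheses (bW : standard_brownian_motion W) (t0 : 0 < t) (tt' : t <= t').
Hypothesis m0 : 0 <= m.
Hypothesis mM : measurable_fun [set: T] M.

Local Notation Z := (drifted W mu).
Local Notation Y := (drifted_increment W mu t t').

Hypothesis hM : {ae P, forall w,
  [set Z s w | s in `[0, t]] (M w) /\ ubound [set Z s w | s in `[0, t]] (M w)}.

Let mZ A : measurable A -> measurable (Z t @^-1` A).
Proof. by move=> mA; rewrite -[_ @^-1` _]setTI; exact: measurable_drifted. Qed.

Let mY A : measurable A -> measurable (Y @^-1` A).
Proof.
by move=> mA; rewrite -[_ @^-1` _]setTI; exact: measurable_drifted_increment.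
Qed.

Let mMm : measurable (M @^-1` `]-oo, m]).
Proof. by rewrite -[_ @^-1` _]setTI; exact: mM. Qed.

Lemma drifted_increment_independent A B : measurable A -> measurable B ->
  P (Z t @^-1` A `&` Y @^-1` B) = (P (Z t @^-1` A) * P (Y @^-1` B))%E.
Proof.
(* The grid has the two times 0 and [t], with no condition at time 0. *)
move=> mA mB; pose s j : R := if j is 0%N then 0 else t.
pose C j : set R := if j is 0%N then setT else A.
have s_nd : {homo s : i j / (i <= j)%N >-> i <= j}.
  by move=> [|i] [|j]//= _; exact: ltW.
have mC j : measurable (C j) by rewrite /C; case: j.
have [_] := drifted_past_independent mu bW (erefl : s 0%N = 0) s_nd
  (tt' : s 1%N <= t') mC mB.
rewrite (_ : [set w | _] = Z t @^-1` A)//.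
by apply/seteqP; split=> [w H|w Aw j]; [exact: (H 1%N (leqnn _))|case: j => [|[|]]].
Qed.

Lemma grid_no_crossing_prob_cvg F : measurable F ->
  (P (~` grid_crossing W mu t m n `&` F) @[n --> \oo] -->
   P (M @^-1` `]-oo, m] `&` F))%E.
Proof.
move=> mF.
have mG n : measurable (~` grid_crossing W mu t m n).
  by apply: measurableC; exact: measurable_grid_crossing.
have [] := @dominated_convergence _ _ _ P F mF
  (fun n w => (\1_(~` grid_crossing W mu t m n) w)%:E)
  (fun w => (\1_(M @^-1` `]-oo, m]) w)%:E) (cst 1%E).
- by move=> n; apply: measurable_funTS; apply/measurable_EFinP.
- by apply: measurable_funTS; apply/measurable_EFinP.
- have [N [mN N0 sN]] := grid_crossing_indic_cvg m bW t0 hM.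
  exists N; split=> // w nw; apply: sN => H; apply: nw => _.
  apply: cvg_near_cst; apply: filterS H => n.
  rewrite !indicE => H; congr (_%:E); congr (nat_of_bool _)%:R.
  have {H} : (w \in grid_crossing W mu t m n) = (w \in M @^-1` `]m, +oo[).
    move: H; case: (_ \in _); case: (_ \in _) => //=; [|move/esym];
      by move/eqP; rewrite oner_eq0.
  rewrite in_setC => ->; apply/idP/idP.
    rewrite notin_setE/= in_itv/= andbT => /negP; rewrite -leNgt => Mm.
    by rewrite inE/= in_itv.
  rewrite inE/= in_itv/= => Mm; rewrite notin_setE/= in_itv/= andbT.
  by apply/negP; rewrite -leNgt.
- apply: (integrableS measurableT) => //.
  exact: finite_measure_integrable_cst.
- apply: aeW => w n _; rewrite lee_fin indicE.
  by case: (_ \in _); rewrite ?normr1 ?normr0.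
- move=> _ _; rewrite integral_indic//.
  suff -> : (fun n => P (~` grid_crossing W mu t m n `&` F)) =
      (fun n => \int[P]_(w in F) (\1_(~` grid_crossing W mu t m n) w)%:E)%E by [].
  by apply/funext => n; rewrite integral_indic.
Qed.

(** The event M <= m involves the whole path, but it is the almost sure limit of the events of no
    crossing on a grid, each of which is independent of the increment after [t]. *)
Lemma max_independent A B : measurable A -> measurable B ->
  P (M @^-1` `]-oo, m] `&` Z t @^-1` A `&` Y @^-1` B) =
  (P (M @^-1` `]-oo, m] `&` Z t @^-1` A) * P (Y @^-1` B))%E.
Proof.
move=> mA mB; rewrite -setIA.
have c1 := grid_no_crossing_prob_cvg (measurableI _ _ (mZ mA) (mY mB)).
have c2 := grid_no_crossing_prob_cvg (mZ mA).
suff c3 : (P (~` grid_crossing W mu t m n `&` (Z t @^-1` A `&` Y @^-1` B))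
    @[n --> \oo] --> P (M @^-1` `]-oo, m] `&` Z t @^-1` A) * P (Y @^-1` B))%E.
  exact: (cvg_unique _ c1 c3).
have -> : (fun n => P (~` grid_crossing W mu t m n `&`
      (Z t @^-1` A `&` Y @^-1` B))) =
    (fun n => P (~` grid_crossing W mu t m n `&` Z t @^-1` A) * P (Y @^-1` B))%E.
  apply/funext => n; rewrite setIA.
  (* The grid ends at [t], so the condition at index [n.+1] carries both the bound by [m] and the
     event on [Z t]. *)
  pose C j : set R := if (j <= n)%N then `]-oo, m]%classic
                      else `]-oo, m] `&` A.
  have -> : ~` grid_crossing W mu t m n `&` Z t @^-1` A =
      [set w | forall j, (j <= n.+1)%N -> C j (Z (grid t n j) w)].
    apply/seteqP; split=> w.
      move=> [nG Aw] j jn.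
      have Zm : Z (grid t n j) w <= m.
        by rewrite leNgt; apply/negP => mZj; apply: nG; exists j.
      rewrite /C; case: ifPn => [_|]; first by rewrite /= in_itv.
      rewrite -ltnNge => nj; have -> : j = n.+1 by apply/eqP; rewrite eqn_leq jn.
      split; last by rewrite gridn.
      by rewrite /= in_itv/=; move: Zm; rewrite (_ : j = n.+1)//; apply/eqP; rewrite eqn_leq jn.
    move=> H; split.
      move=> [k kn]; apply/negP; rewrite -leNgt.
      by have := H k kn; rewrite /C; case: ifP => _; [|move=> []]; rewrite /= in_itv.
    by have := H n.+1 (leqnn _); rewrite /C ltnn gridn => -[].
  have mC j : measurable (C j) by rewrite /C; case: ifP => // _; exact: measurableI.
  have gt : grid t n n.+1 <= t' by rewrite gridn.
  have [_] := drifted_past_independent mu bW (grid0 t n) (@grid_nd _ t t0 n) gt mC mB.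
  by rewrite gridn.
by apply: cvgeZr => //; apply: fin_num_measure; exact: mY.
Qed.

Let mUp : measurable_fun [set: T] (fun w => Z t w + 2 * m).
Proof. by apply: measurable_funD => //; exact: measurable_drifted. Qed.

Let mEm : measurable (M @^-1` `]-oo, m] `&` Z t @^-1` `]-oo, m[).
Proof. by apply: measurableI => //; exact: mZ. Qed.

Let mE_lt c : measurable (Z t @^-1` `]-oo, c[).
Proof. exact: mZ. Qed.

Let U : {mfun T >-> R} := mfun_of (@measurable_drifted _ _ _ _ W mu t).
Let Up : {mfun T >-> R} := mfun_of mUp.
Let weight : {nonneg R} := NngNum (expR_ge0 (2 * mu * m)).

Let sum_lawE (A : set R) : measure_add (restricted_law P U mEm)
    (mscale weight (restricted_law P Up (mE_lt (- m)))) A =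
  (P (M @^-1` `]-oo, m] `&` Z t @^-1` `]-oo, m[ `&` U @^-1` A) +
   (expR (2 * mu * m))%:E * P (Z t @^-1` `]-oo, (- m)%R[ `&` Up @^-1` A))%E.
Proof.
rewrite measure_addE; congr (_ + _)%E; first exact: restricted_lawE.
by congr (_ * _)%E; exact: restricted_lawE.
Qed.

(** The mass where Z_t < m splits according to M <= m or M > m. By the crossing identity the second
    part is the law of Z_t + 2 m on Z_t < - m, weighted by exp (2 mu m). All these measures are
    carried by []-oo, m[]. *)
Lemma reflection_law (A : set R) : measurable A ->
  measure_add (restricted_law P U mEm)
    (mscale weight (restricted_law P Up (mE_lt (- m)))) A =
  restricted_law P U (mE_lt m) A.
Proof.
apply: (@finite_measure_cdf_unique_lt R _ _ m).
- rewrite [ltLHS]sum_lawE !preimage_setT !setIT.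
  by rewrite ltey_eq fin_numD fin_numM ?fin_num_measure.
- move=> a am; rewrite [LHS]sum_lawE [RHS]restricted_lawE.
  have Zam : Z t @^-1` `]-oo, m[ `&` Z t @^-1` `]-oo, a] = Z t @^-1` `]-oo, a].
    rewrite -preimage_setI; congr (_ @^-1` _); rewrite setIidr//.
    by move=> x /=; rewrite !in_itv/= => /le_lt_trans; exact.
  rewrite -setIA Zam.
  have -> : Z t @^-1` `]-oo, (- m)%R[ `&` Up @^-1` `]-oo, a] =
      Z t @^-1` `]-oo, (a - 2 * m)%R].
    apply/seteqP; split=> w; rewrite /Up /= !in_itv/=; first by case=> _; lra.
    by move=> h; split; lra.
  rewrite -(crossing_distribution bW t0 m0 mM hM am).
  rewrite -measureU; last 3 first.
  + by apply: measurableI => //; exact: mZ.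
  + apply: measurableI; last exact: mZ.
    by rewrite -[_ @^-1` _]setTI; exact: mM.
  + rewrite -subset0 => w /= [[] /=]; rewrite !in_itv/= andbT => Mm _ [mM' _].
    by move: mM'; rewrite ltNge Mm.
  rewrite -setIUl -preimage_setU -[X in _ = P X]setTI; congr (P (_ `&` _)).
  apply/seteqP; split=> // w _ /=; rewrite !in_itv/= andbT.
  by case: (leP (M w) m); [left|right].
- rewrite [LHS]sum_lawE.
  rewrite [X in P X](_ : _ = set0) ?[in X in (_ + X)%E](_ : _ `&` _ = set0).
  + by rewrite !measure0 mule0 adde0.
  + by rewrite -subset0 => w [] /=; rewrite !in_itv/= andbT; lra.
  + rewrite -subset0 => w [[_]] /=; rewrite !in_itv/= andbT => h.
    by rewrite leNgt h.
- rewrite [LHS]restricted_lawE -preimage_setI (_ : _ `&` _ = set0).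
    by rewrite preimage_set0 measure0.
  rewrite -subset0 => x [] /=; rewrite !in_itv/= andbT => h.
  by rewrite leNgt h.
Qed.

(** Each of the three laws is independent of the increment [Y], so each joint probability is the
    integral of the probability that [Y] falls in a section of [S]; [reflection_law] then relates
    the integrating measures. *)
Lemma reflection_joint_law S : measurable S ->
  (P (M @^-1` `]-oo, m] `&` Z t @^-1` `]-oo, m[ `&` [set w | S (Z t w, Y w)]) +
   (expR (2 * mu * m))%:E *
   P (Z t @^-1` `]-oo, (- m)%R[ `&` [set w | S (Z t w + 2 * m, Y w)%R]) =
   P (Z t @^-1` `]-oo, m[ `&` [set w | S (Z t w, Y w)]))%E.
Proof.
move=> mS.
pose V := mfun_of (@measurable_drifted_increment _ _ _ _ W mu t t').
rewrite (@restricted_joint_law _ _ _ P U V _ mEm _ S mS); last first.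
  move=> A B mA mB.
  have -> : M @^-1` `]-oo, m] `&` Z t @^-1` `]-oo, m[ `&` U @^-1` A =
    M @^-1` `]-oo, m] `&` Z t @^-1` (`]-oo, m[ `&` A) by rewrite -setIA.
  by apply: max_independent => //; exact: measurableI.
rewrite (@restricted_joint_law _ _ _ P Up V _ (mE_lt (- m)) _ S mS); last first.
  move=> A B mA mB.
  have -> : Z t @^-1` `]-oo, (- m)%R[ `&` Up @^-1` A =
      Z t @^-1` (`]-oo, (- m)%R[ `&` (fun x : R => x + 2 * m)%R @^-1` A) by [].
  apply: drifted_increment_independent => //; apply: measurableI => //.
  by rewrite -[_ @^-1` _]setTI; exact: measurable_funD.
rewrite (@restricted_joint_law _ _ _ P U V _ (mE_lt m) _ S mS); last first.
  move=> A B mA mB; rewrite -preimage_setI.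
  by apply: drifted_increment_independent => //; exact: measurableI.
rewrite /product_measure1.
have mphi : measurable_fun [set: R] (distribution P V \o xsection S).
  exact: measurable_fun_xsection.
rewrite -[RHS](eq_measure_integral _ (fun A mA _ => reflection_law mA)).
by rewrite ge0_integral_measure_add// ge0_integral_mscale.
Qed.

Lemma drifted_atomless c : P (Z t @^-1` [set c]) = 0%E.
Proof. by rewrite (drifted_law mu bW t0)// normal_prob_set1. Qed.

(** Here [S] is the half-plane z1 + z2 <= x, and the translation by 2 m in the first coordinate
    lowers the bound on [Z t'] to x - 2 m. Strict bounds become weak ones because [Z t] has no
    atoms, and Z_t <= M absorbs the condition on [Z t] in the first term. *)
Lemma max_drifted_distribution x :
  (P (M @^-1` `]-oo, m] `&` Z t' @^-1` `]-oo, x]) +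
   (expR (2 * mu * m))%:E *
   P (Z t @^-1` `]-oo, (- m)%R] `&` Z t' @^-1` `]-oo, (x - 2 * m)%R]) =
   P (Z t @^-1` `]-oo, m] `&` Z t' @^-1` `]-oo, x]))%E.
Proof.
pose S : set (R * R) := [set z | z.1 + z.2 <= x].
have mS : measurable S.
  have -> : S = (fun z : R * R => z.1 + z.2) @^-1` `]-oo, x].
    by apply/seteqP; split=> z; rewrite /S/= in_itv.
  by rewrite -[_ @^-1` _]setTI; exact: measurable_funD.
have mZ' y : measurable (Z t' @^-1` `]-oo, y]).
  by rewrite -[_ @^-1` _]setTI; apply: measurable_drifted.
have ne c : {ae P, forall w, Z t w <> c}.
  exists (Z t @^-1` [set c]); split; first exact: mZ.
    exact: drifted_atomless.
  by move=> w /= /contrapT.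
have SE : [set w | S (Z t w, Y w)] = Z t' @^-1` `]-oo, x].
  by apply/seteqP; split=> w; rewrite /S/= in_itv/= driftedD.
have SE' : [set w | S (Z t w + 2 * m, Y w)%R] = Z t' @^-1` `]-oo, (x - 2 * m)%R].
  by apply/seteqP; split=> w; rewrite /S/= in_itv/= addrAC driftedD lerBrDr.
have := reflection_joint_law mS; rewrite SE SE'.
have -> : P (M @^-1` `]-oo, m] `&` Z t @^-1` `]-oo, m[ `&` Z t' @^-1` `]-oo, x]) =
    P (M @^-1` `]-oo, m] `&` Z t' @^-1` `]-oo, x]).
  apply: measure_ae_eq; [exact: measurableI|exact: measurableI|].
  apply: filterS2 (ne m) (max_ge_drifted t0 hM) => w Zm ZM.
  rewrite /= !in_itv/=; split; first by move=> [[]].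
  move=> [Mm Zx]; split=> //; split=> //.
  by rewrite lt_neqAle (le_trans ZM)// andbT; apply/eqP.
have -> : P (Z t @^-1` `]-oo, (- m)%R[ `&` Z t' @^-1` `]-oo, (x - 2 * m)%R]) =
    P (Z t @^-1` `]-oo, (- m)%R] `&` Z t' @^-1` `]-oo, (x - 2 * m)%R]).
  apply: measure_ae_eq; [by apply: measurableI => //; exact: mZ..|].
  apply: filterS (ne (- m)) => w Zm; rewrite /= !in_itv/=; split=> -[Zm' Zx]; split=> //.
    exact: ltW.
  by rewrite lt_neqAle Zm' andbT; apply/eqP.
move=> ->; apply: measure_ae_eq; [by apply: measurableI => //; exact: mZ..|].
apply: filterS (ne m) => w Zm; rewrite /= !in_itv/=; split=> -[Zm' Zx]; split=> //.
  exact: ltW.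
by rewrite lt_neqAle Zm' andbT; apply/eqP.
Qed.

End joint_distribution.

(** * Bivariate normal distribution *)

Lemma standardizeE (R : realType) (c s x : R) :
  s^-1 * x + - c / s = (x - c) / s.
Proof. by rewrite mulrDl (mulrC x). Qed.

Section bivariate_normal.
Context d (T : measurableType d) (R : realType) (P : probability T R).
Variables (W : R -> {RV P >-> R}) (mu t t' : R).
Hypotheses (bW : standard_brownian_motion W) (t0 : 0 < t).

Local Notation Z := (drifted W mu).

Lemma normal_prob_standardize (c s : R) (A : set R) : 0 < s -> measurable A ->
  normal_prob c s ((fun x => s^-1 * x + - c / s) @^-1` A) = normal_prob 0 1 A.
Proof.
move=> s0 mA; have si0 : 0 < s^-1 by rewrite invr_gt0.
have := @normal_prob_affine R s^-1 (- c / s) c s A si0 s0 mA.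
have -> : s^-1 * c + - c / s = 0 by rewrite mulNr mulrC subrr.
by have -> : s^-1 * s = 1 by rewrite mulVf ?gt_eqF.
Qed.

Lemma drifted_cdf b :
  P (Z t @^-1` `]-oo, b]) = normal_prob 0 1 `]-oo, (b - mu * t) / Num.sqrt t].
Proof.
have s0 : 0 < Num.sqrt t by rewrite sqrtr_gt0.
apply: (etrans (drifted_law mu bW t0 (measurable_itv `]-oo, b]))).
have mb : measurable (`]-oo, (b - mu * t) / Num.sqrt t] : set R) by [].
rewrite -(normal_prob_standardize (mu * t) s0 mb).
congr (normal_prob _ _ _); apply/seteqP; split=> x; rewrite /= !in_itv/=;
  by rewrite standardizeE ler_pM2r ?invr_gt0// lerD2r.
Qed.

(** The standardized position at [t] and increment from [t] to [t'] are independent standard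
    normals. The standardized position at [t'] combines them with coefficients sqrt (t / t') and
    sqrt ((t' - t) / t'). Standardizing the increment requires t < t'. *)
Lemma drifted_bivariate_cdf_lt a b : t < t' ->
  P (Z t @^-1` `]-oo, b] `&` Z t' @^-1` `]-oo, a]) =
  ((normal_prob 0 1 \x normal_prob 0 1)
    [set g : R * R | (g.1 <= (b - mu * t) / Num.sqrt t)%R /\
      (Num.sqrt (t / t') * g.1 + Num.sqrt ((t' - t) / t') * g.2
         <= (a - mu * t') / Num.sqrt t')%R])%E.
Proof.
move=> tt'.
have t'0 : 0 < t' by exact: lt_trans tt'.
have d0 : 0 < t' - t by rewrite subr_gt0.
pose s1 := Num.sqrt t; pose s2 := Num.sqrt (t' - t); pose s3 := Num.sqrt t'.
have s10 : 0 < s1 by rewrite sqrtr_gt0.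
have s20 : 0 < s2 by rewrite sqrtr_gt0.
have s30 : 0 < s3 by rewrite sqrtr_gt0.
pose f1 (x : measurableTypeR R) : measurableTypeR R := s1^-1 * x + - (mu * t) / s1.
pose f2 (x : measurableTypeR R) : measurableTypeR R :=
  s2^-1 * x + - (mu * (t' - t)) / s2.
pose Y := drifted_increment W mu t t'.
have mf1 : measurable_fun setT f1 by exact: measurable_affine.
have mf2 : measurable_fun setT f2 by exact: measurable_affine.
have mf1A A : measurable A -> measurable (f1 @^-1` A).
  by move=> mA; rewrite -[_ @^-1` _]setTI; exact: mf1.
have mf2A A : measurable A -> measurable (f2 @^-1` A).
  by move=> mA; rewrite -[_ @^-1` _]setTI; exact: mf2.
pose G w : measurableTypeR R * measurableTypeR R := (f1 (Z t w), f2 (Y w)).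
have mG : measurable_fun setT G.
  apply: measurable_fun_pair.
    by apply: (measurableT_comp mf1); exact: measurable_drifted.
  by apply: (measurableT_comp mf2); exact: measurable_drifted_increment.
set S := (X in _ = (_ \x _)%E X).
have mS : measurable (S : set (measurableTypeR R * measurableTypeR R)).
  apply: measurableI.
    by rewrite -[X in measurable X]setTI; apply: measurable_fun_le.
  rewrite -[X in measurable X]setTI; apply: measurable_fun_le => //.
  by apply: measurable_funD; apply: measurable_funM.
pose m' := distribution P (mfun_of mG).
rewrite [RHS](product_measure_unique (m' := m'))//; last first.
  move=> A B mA mB.
  transitivity (P (Z t @^-1` (f1 @^-1` A) `&` Y @^-1` (f2 @^-1` B))); first by [].
  rewrite (drifted_increment_independent mu bW t0 (ltW tt') (mf1A _ mA) (mf2A _ mB)).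
  rewrite (drifted_law mu bW t0 (mf1A _ mA)).
  rewrite (drifted_increment_law mu bW (ltW t0) tt' (mf2A _ mB)).
  congr (_ * _)%E; first exact: (normal_prob_standardize (mu * t) s10 mA).
  exact: (normal_prob_standardize (mu * (t' - t)) s20 mB).
transitivity (P (G @^-1` S)); last by [].
have SE w : (Num.sqrt (t / t') * f1 (Z t w) + Num.sqrt ((t' - t) / t') * f2 (Y w)
    <= (a - mu * t') / Num.sqrt t') = (Z t' w <= a).
  rewrite /f1 /f2 !standardizeE !sqrtrM ?(ltW t0) ?(ltW d0)// sqrtrV ?(ltW t'0)//.
  rewrite -/s1 -/s2 -/s3 -(driftedD W mu t t' w) -/(Y w).
  have -> : s1 / s3 * ((Z t w - mu * t) / s1) +
      s2 / s3 * ((Y w - mu * (t' - t)) / s2) = (Z t w + Y w - mu * t') / s3.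
    by field; rewrite !gt_eqF.
  by rewrite ler_pM2r ?invr_gt0// lerD2r.
have SE1 w : (f1 (Z t w) <= (b - mu * t) / Num.sqrt t) = (Z t w <= b).
  by rewrite /f1 standardizeE ler_pM2r ?invr_gt0// lerD2r.
congr (P _); apply/seteqP; split=> w; rewrite /S/= !in_itv/= SE SE1; by [].
Qed.

Lemma drifted_bivariate_cdf a b : t <= t' ->
  P (Z t @^-1` `]-oo, b] `&` Z t' @^-1` `]-oo, a]) =
  (Phi2 ((a - mu * t') / Num.sqrt t') ((b - mu * t) / Num.sqrt t)
    (Num.sqrt (t / t')))%:E.
Proof.
move=> tt'; have t'0 : 0 < t' by exact: lt_le_trans tt'.
have mZ c y : measurable (Z c @^-1` `]-oo, y]).
  by rewrite -[_ @^-1` _]setTI; apply: measurable_drifted.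
rewrite -[LHS]fineK ?fin_num_measure//; last exact: measurableI.
rewrite /Phi2; congr (fine _)%:E.
move: tt'; rewrite le_eqVlt => /orP[/eqP <-|tt'].
  (* For equal times the correlation is 1 and the second Gaussian coordinate has coefficient 0: both
     events reduce to a half-line with the smaller bound. *)
  rewrite divff ?gt_eqF// sqrtr1 expr1n subrr sqrtr0.
  set c := (_ - _) / _; set e := (_ - _) / _.
  rewrite -preimage_setI.
  have -> : [set g : R * R | g.1 <= c /\ 1 * g.1 + 0 * g.2 <= e] =
      `]-oo, Num.min c e] `*` setT.
    apply/seteqP; split=> g /=; rewrite in_itv/= mul1r mul0r addr0 le_min.
      by move=> [-> ->].
    by move=> [/andP[]].
  rewrite product_measure1E// [X in (_ * X)%E]probability_setT mule1.
  have -> : (`]-oo, b] `&` `]-oo, a] : set R) = `]-oo, Num.min a b]%classic.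
    by apply/seteqP; split=> x /=; rewrite !in_itv/= le_min andbC => /andP.
  rewrite drifted_cdf; congr (normal_prob _ _ _); congr (`]-oo, _]%classic).
  rewrite /c /e; have s0 : 0 < Num.sqrt t by rewrite sqrtr_gt0.
  case: (leP a b) => ab.
    by rewrite min_l// ler_pM2r ?invr_gt0// lerD2r.
  by rewrite min_r// ler_pM2r ?invr_gt0// lerD2r ltW.
have s0 : 0 < Num.sqrt ((t' - t) / t') by rewrite sqrtr_gt0 divr_gt0// subr_gt0.
have rs : Num.sqrt (t / t') ^+ 2 + Num.sqrt ((t' - t) / t') ^+ 2 = 1.
  rewrite !sqr_sqrtr ?divr_ge0 ?subr_ge0 ?(ltW t0) ?(ltW t'0) ?(ltW tt')//.
  by rewrite -mulrDl addrC subrK divff// gt_eqF.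
have -> : Num.sqrt (1 - Num.sqrt (t / t') ^+ 2) = Num.sqrt ((t' - t) / t').
  rewrite sqr_sqrtr ?divr_ge0 ?(ltW t0) ?(ltW t'0)//.
  by rewrite mulrBl divff// gt_eqF.
apply: (etrans (drifted_bivariate_cdf_lt a b tt')).
(* The symmetry puts the later time first, as in [Phi2]. *)
exact: (normal_bivariate_sym _ _ s0 rs).
Qed.

End bivariate_normal.

(** * Distribution functions and copulas *)

Section distribution_functions.
Context d (T : measurableType d) (R : realType) (P : probability T R).
Implicit Types (X Y : {RV P >-> R}).

Lemma measurable_RV_le X (x : R) : measurable (X @^-1` `]-oo, x]).
Proof. by rewrite -[_ @^-1` _]setTI; exact: measurable_funP. Qed.

Lemma distr_funE X x : (distr_fun X x)%:E = P (X @^-1` `]-oo, x]).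
Proof. by rewrite /distr_fun fineK// fin_num_measure//; exact: measurable_RV_le. Qed.

Lemma distr_fun_bnd X x : 0 <= distr_fun X x <= 1.
Proof.
rewrite -!lee_fin distr_funE measure_ge0/=.
by apply: probability_le1; exact: measurable_RV_le.
Qed.

Lemma distr_fun_nd X : {homo distr_fun X : x y / x <= y}.
Proof.
move=> x y xy; rewrite -lee_fin !distr_funE.
apply: le_measure; rewrite ?inE; try exact: measurable_RV_le.
by move=> w /=; rewrite !in_itv/= => /le_trans; exact.
Qed.

Lemma distr_fun_cvg0 X : distr_fun X x @[x --> -oo] --> (0 : R).
Proof. by apply: fine_cvg; exact: cvg_cdfNy0. Qed.

Lemma distr_fun_cvg1 X : distr_fun X x @[x --> +oo] --> (1 : R).
Proof. by apply: fine_cvg; exact: cvg_cdfy1. Qed.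

(** By continuity, if F exceeded u at the infimum q, then so it would at a point left of q, which is
    absurd. If F were below u at q, a point right of q would still be a lower bound of the set. *)
Lemma distr_fun_quantile X u : continuous (distr_fun X) -> 0 < u < 1 ->
  distr_fun X (quantile (distr_fun X) u) = u.
Proof.
move=> cF /andP[u0 u1]; set F := distr_fun X; rewrite /quantile.
set S := [set x | u <= F x]; set q := inf S.
have [x0 x0S] : S !=set0.
  have /cvgr_gt/(_ _ u1)/(@filter_ex R +oo) [x ux] := @distr_fun_cvg1 X.
  by exists x; exact: ltW.
have [y0 y0u] : exists y, F y < u.
  by have /cvgr_lt/(_ _ u0)/(@filter_ex R -oo) := @distr_fun_cvg0 X.
have lbS y : F y < u -> lbound S y.
  move=> yu x /= ux; rewrite leNgt; apply/negP => /ltW/(distr_fun_nd X).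
  by rewrite leNgt (lt_le_trans yu ux).
have hiS : has_inf S by split; [exists x0|exists y0; exact: lbS].
have qlb x : S x -> q <= x by apply: ge_inf; case: hiS.
apply/eqP; rewrite eq_le !leNgt; apply/andP; split; apply/negP => h.
  have [e /= e0 He] := (nbhs_ballP _ _).1 (cvgr_gt _ (cF q) _ h).
  have : F (q - e / 2) > u.
    apply: He; rewrite /ball/= opprD addrA subrr sub0r opprK.
    by rewrite gtr0_norm ?divr_gt0//; lra.
  by move=> /ltW/qlb; lra.
have [e /= e0 He] := (nbhs_ballP _ _).1 (cvgr_lt _ (cF q) _ h).
have Fe : F (q + e / 2) < u.
  apply: He; rewrite /ball/= opprD addrA subrr sub0r normrN.
  by rewrite gtr0_norm ?divr_gt0//; lra.
have : q + e / 2 <= q by apply: lb_le_inf; [case: hiS|exact: lbS].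
lra.
Qed.

Lemma measurable_distr_fun X : measurable_fun [set: R] (distr_fun X).
Proof. by apply: nondecreasing_measurable => //; exact: distr_fun_nd. Qed.

(** Flat pieces of F prevent an exact identification of the event F (X) <= u with a half-line event.
    For 0 < u < 1 it contains the event that X is at most the u-quantile, and it is contained in the
    one for the v-quantile for every v in []u, 1[]. *)
Lemma probability_integral_transform X u : continuous (distr_fun X) ->
  P ((fun w => distr_fun X (X w)) @^-1` `]-oo, u]) =
  (Num.max 0 (Num.min u 1))%:E.
Proof.
move=> cF; set F := distr_fun X; set A := _ @^-1` _.
have mA (v : R) : measurable ((fun w => F (X w)) @^-1` `]-oo, v]).
  rewrite -[_ @^-1` _]setTI.
  by apply: (measurableT_comp (measurable_distr_fun X)).
have ub v : u < v -> 0 < v < 1 -> (P A <= v%:E)%E.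
  move=> uv v01; have Fq := distr_fun_quantile cF v01.
  rewrite -Fq distr_funE; apply: le_measure; rewrite ?inE.
  - exact: mA.
  - exact: measurable_RV_le.
  move=> w; rewrite /A/= !in_itv/= => Fu; rewrite leNgt; apply/negP => /ltW/(distr_fun_nd X).
  by rewrite Fq leNgt (le_lt_trans Fu uv).
have [u1|u1] := leP 1 u.
  rewrite max_r//; suff -> : A = setT by rewrite probability_setT.
  apply/seteqP; split=> // w _; rewrite /A/= in_itv/= (le_trans _ u1)//.
  by case/andP: (distr_fun_bnd X (X w)).
have [u0|u0] := leP u 0.
  apply/eqP; rewrite eq_le measure_ge0 andbT.
  apply/lee_addgt0Pr => e e0; rewrite add0e.
  pose v := Num.min e 2^-1.
  have v0 : 0 < v by rewrite lt_min e0/= invr_gt0.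
  have v1 : v < 1 by rewrite gt_min; apply/orP; right; lra.
  apply: (@le_trans _ _ v%:E); last by rewrite lee_fin ge_min lexx.
  by apply: ub; rewrite ?v0//; exact: le_lt_trans v0.
apply/eqP; rewrite eq_le; apply/andP; split.
  (* The midpoint of [u] and 1 keeps [v] below 1, where it still has a quantile. *)
  apply/lee_addgt0Pr => e e0; pose v := Num.min (u + e) ((u + 1) / 2).
  have uv : u < v by rewrite lt_min ltrDl e0/=; lra.
  have v1 : v < 1 by rewrite gt_min; apply/orP; right; lra.
  apply: (@le_trans _ _ v%:E); last by rewrite lee_fin ge_min lexx.
  by apply: ub => //; rewrite v1 (lt_trans u0 uv).
have u01 : 0 < u < 1 by rewrite u0.
have Fq := distr_fun_quantile cF u01.
rewrite -[leLHS]/(u%:E) -[in leLHS]Fq distr_funE; apply: le_measure; rewrite ?inE.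
- exact: measurable_RV_le.
- exact: mA.
by move=> w; rewrite /A/= !in_itv/= => /(distr_fun_nd X); rewrite Fq.
Qed.

End distribution_functions.

Lemma uniform_prob_cdf (R : realType) (u : R) :
  uniform_prob (@ltr01 R) `]-oo, u] = (Num.max 0 (Num.min u 1))%:E.
Proof.
rewrite /uniform_prob integral_uniform_pdf.
have -> : `]-oo, u] `&` `[0, 1] = `[0, Num.min u 1]%classic :> set R.
  apply/seteqP; split=> x /=; rewrite !in_itv/= le_min.
    by move=> [-> /andP[-> ->]].
  by move=> /andP[-> /andP[-> ->]].
rewrite (eq_integral (fun=> 1%:E)); last first.
  move=> x; rewrite inE/= in_itv/= le_min /uniform_pdf subr0 invr1.
  by move=> /andP[-> /andP[_ ->]].
rewrite integral_cst//= mul1e lebesgue_measure_itv/= lte_fin.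
case: ifPn => [h|]; first by rewrite -EFinB subr0 max_r// ltW.
by rewrite -leNgt => h; rewrite max_l.
Qed.

Section copulas.
Context d (T : measurableType d) (R : realType) (P : probability T R).
Variables X Y : {RV P >-> R}.
Hypotheses (cX : continuous (distr_fun X)) (cY : continuous (distr_fun Y)).

Let mFX : measurable_fun [set: T] (fun w => distr_fun X (X w)).
Proof. by apply: (measurableT_comp (measurable_distr_fun X)). Qed.

Let mFY : measurable_fun [set: T] (fun w => distr_fun Y (Y w)).
Proof. by apply: (measurableT_comp (measurable_distr_fun Y)). Qed.

Let mFXY : measurable_fun [set: T]
  (fun w => (distr_fun X (X w), distr_fun Y (Y w))).
Proof. exact: measurable_fun_pair. Qed.

Let transform_uniform (Z : {RV P >-> R}) (A : set R) :
  continuous (distr_fun Z) -> measurable A ->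
  P ((fun w => distr_fun Z (Z w)) @^-1` A) = uniform_prob (@ltr01 R) A.
Proof.
move=> cZ mA.
have mFZ : measurable_fun [set: T] (fun w => distr_fun Z (Z w)).
  by apply: (measurableT_comp (measurable_distr_fun Z)).
(* [uniform_prob] is a measure on [measurableTypeR R], which differs from [R] by
   its display; [idfun] transports it. *)
have mid : measurable_fun setT (idfun : measurableTypeR R -> R).
  by move=> _ B mB; rewrite setTI; exact: mB.
apply: (@finite_measure_cdf_unique R (distribution P (mfun_of mFZ))
  (distribution (uniform_prob (@ltr01 R)) (mfun_of mid))) => // a.
  by apply: (le_lt_trans (probability_le1 _ _)); rewrite ?ltry.
transitivity (uniform_prob (@ltr01 R) `]-oo, a]); last by [].
by rewrite uniform_prob_cdf -(probability_integral_transform a cZ).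
Qed.

(** One event contains the other, and the integral transform gives both the probability
    [distr_fun Z x]; their difference, due to flat pieces, is null. *)
Let transform_ae (Z : {RV P >-> R}) (x : R) : continuous (distr_fun Z) ->
  {ae P, forall w, (Z w <= x) <-> (distr_fun Z (Z w) <= distr_fun Z x)}.
Proof.
move=> cZ.
have mFZ : measurable ((fun w => distr_fun Z (Z w)) @^-1` `]-oo, distr_fun Z x]).
  rewrite -[_ @^-1` _]setTI.
  by apply: (measurableT_comp (measurable_distr_fun Z)).
have mZ := measurable_RV_le Z x.
have ZF : Z @^-1` `]-oo, x] `<=`
    (fun w => distr_fun Z (Z w)) @^-1` `]-oo, distr_fun Z x].
  by move=> w; rewrite /= !in_itv/=; exact: distr_fun_nd.
exists ((fun w => distr_fun Z (Z w)) @^-1` `]-oo, distr_fun Z x] `\`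
  Z @^-1` `]-oo, x]); split.
- exact: measurableD.
- rewrite measureD ?ltey_eq ?fin_num_measure// setIidr//.
  have /andP[F0 F1] := distr_fun_bnd Z x.
  transitivity ((distr_fun Z x)%:E - (distr_fun Z x)%:E)%E; last first.
    by rewrite -EFinB subrr.
  congr (_ - _)%E; last exact/esym/distr_funE.
  rewrite [LHS](probability_integral_transform _ cZ).
  by rewrite min_l// max_r.
- move=> w /= nw; split; rewrite !in_itv/=.
    rewrite leNgt; apply/negP => Fw; apply: nw; split=> [|h].
      exact: distr_fun_nd.
    by move: Fw; rewrite ltNge h.
  by move=> Zx; apply: nw; split=> [_|_]; [exact: distr_fun_nd|exact: Zx].
Qed.

(** The witness is the joint distribution function of the transformed pair (F_X(X), F_Y(Y)), whose
    margins are uniform; the factorization holds because the transformed events agree almost surely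
    with the original ones. *)
Lemma copula_exists : exists C, is_copula_of X Y C.
Proof.
exists (fun u v => fine (P ((fun w => distr_fun X (X w)) @^-1` `]-oo, u] `&`
                            (fun w => distr_fun Y (Y w)) @^-1` `]-oo, v]))).
have mA (u v : R) : measurable ((fun w => distr_fun X (X w)) @^-1` `]-oo, u] `&`
                      (fun w => distr_fun Y (Y w)) @^-1` `]-oo, v]).
  apply: measurableI.
    by rewrite -[_ @^-1` _]setTI; exact: mFX.
  by rewrite -[_ @^-1` _]setTI; exact: mFY.
split.
  exists (distribution P (mfun_of mFXY)); split.
  - move=> A mA'; rewrite -(transform_uniform cX mA').
    by congr (P _); apply/seteqP; split=> w //= -[].
  - move=> A mA'; rewrite -(transform_uniform cY mA').
    by congr (P _); apply/seteqP; split=> w //= -[].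
  - by move=> u v _ _; rewrite fineK// fin_num_measure.
move=> x y; rewrite /joint_distr_fun; congr fine.
apply: measure_ae_eq => //.
  rewrite (_ : [set w | _] = X @^-1` `]-oo, x] `&` Y @^-1` `]-oo, y]).
    by apply: measurableI; exact: measurable_RV_le.
  by apply/seteqP; split=> w; rewrite /= !in_itv.
apply: filterS2 (transform_ae x cX) (transform_ae y cY) => w Xx Yy.
by rewrite /= !in_itv/=; split=> -[/Xx ? /Yy ?].
Qed.

(** Existence ensures that [xget] returns some copula of the pair, and the factorization property
    fixes the value of any such copula at these arguments. *)
Lemma copula_distr_fun x y :
  copula X Y (distr_fun X x) (distr_fun Y y) = joint_distr_fun X Y x y.
Proof.
have [C hC] := copula_exists; rewrite /copula.
by case: xgetP => [C' _ [_ ->]//|/(_ C)].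
Qed.

End copulas.

Lemma normal_prob_itv_le (R : realType) (a b : R) : a <= b ->
  (normal_prob 0 1 `]-oo, b] <=
   normal_prob 0 1 `]-oo, a] + (normal_peak 1 * (b - a))%:E)%E.
Proof.
move=> ab.
have -> : `]-oo, b]%classic = `]-oo, a] `|` `]a, b] :> set R.
  apply/seteqP; split=> x; rewrite /= !in_itv/=.
    by move=> ->; rewrite andbT; case: (leP x a); [left|right].
  by case=> [/le_trans|/andP[]//]; exact.
rewrite measureU//; last first.
  rewrite -subset0 => x [] /=; rewrite !in_itv/= => xa /andP[ax _].
  by move: ax; rewrite ltNge xa.
apply: leeD => //; rewrite /normal_prob.
apply: (@le_trans _ _ (\int[lebesgue_measure]_(x in `]a, b]) (normal_peak 1)%:E)%E).
  apply: ge0_le_integral => //.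
  - by move=> x _; rewrite lee_fin normal_pdf_ge0.
  - by apply: measurable_funTS; apply/measurable_EFinP; exact: measurable_normal_pdf.
  - by move=> x _; rewrite lee_fin normal_pdf_ub.
rewrite integral_cst//= lebesgue_measure_itv/= lte_fin.
move: ab; rewrite le_eqVlt => /orP[/eqP ->|ab].
  by rewrite ltxx mule0 subrr mulr0.
by rewrite ab -EFinB -EFinM.
Qed.

Lemma PhiE (R : realType) (z : R) : (Phi z)%:E = normal_prob 0 1 `]-oo, z].
Proof. by rewrite /Phi fineK// fin_num_measure. Qed.

Lemma Phi_continuous (R : realType) : continuous (@Phi R).
Proof.
have K0 := @normal_peak_ge0 R 1.
have step (a b : R) : a <= b -> `|Phi a - Phi b| <= normal_peak 1 * `|a - b|.
  move=> ab; have := normal_prob_itv_le ab.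
  rewrite -!PhiE -EFinD lee_fin => h.
  have : Phi a <= Phi b.
    rewrite -lee_fin !PhiE; apply: le_measure; rewrite ?inE//.
    by move=> x /=; rewrite !in_itv/= => /le_trans; exact.
  move=> ab'; rewrite distrC (distrC a) !ger0_norm ?subr_ge0//; lra.
have lip (a b : R) : `|Phi a - Phi b| <= normal_peak 1 * `|a - b|.
  have [/step//|/ltW/step] := leP a b.
  by rewrite distrC (distrC b).
move=> x; apply/cvgrPdist_le => e e0.
(* [normal_peak 1] is a Lipschitz constant of [Phi]; adding 1 gives a divisor that is visibly
   positive. *)
have K1 : 0 < normal_peak (1 : R) + 1 by rewrite ltr_pwDr.
near=> y.
apply: (le_trans (lip x y)).
have xy : `|x - y| <= e / (normal_peak 1 + 1).
  near: y; apply: cvgr_dist_le; first exact: cvg_id.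
  by rewrite divr_gt0.
apply: (@le_trans _ _ ((normal_peak 1 + 1) * (e / (normal_peak 1 + 1)))).
  by rewrite ler_pM// lerDl.
by rewrite mulrC divfK// gt_eqF.
Unshelve. all: by end_near. Qed.

(** [Phi] is the distribution function of the identity on the line under the standard normal law, so
    the general quantile lemma applies. *)
Lemma Phi_quantile (R : realType) (u : R) : 0 < u < 1 ->
  Phi (quantile (@Phi R) u) = u.
Proof.
have mid : measurable_fun setT (idfun : measurableTypeR R -> R).
  by move=> _ B mB; rewrite setTI; exact: mB.
have XE : @distr_fun _ _ R (normal_prob (0 : R) 1) (mfun_of mid) = @Phi R.
  by apply/funext => z.
have := @distr_fun_quantile _ _ R (normal_prob (0 : R) 1) (mfun_of mid) u.
by rewrite XE => h u01; apply: h => //; exact: Phi_continuous.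
Qed.

(** * Marginal distribution functions of the terminal value and the maximum *)

Section drifted_marginals.
Context d (T : measurableType d) (R : realType) (P : probability T R).
Variables (W : R -> {RV P >-> R}) (mu : R).
Hypothesis bW : standard_brownian_motion W.

Lemma add_drift_ae : {ae P, forall w, forall s,
  add_drift W mu s w = drifted W mu s w}.
Proof.
have [N [mN N0 sN]] := bm_start bW.
exists N; split=> // w nw; apply: sN => W0; apply: nw => s.
by rewrite /drifted W0 subr0.
Qed.

Lemma add_drift_distr_fun s x : 0 < s ->
  distr_fun (add_drift W mu s) x = Phi ((x - mu * s) / Num.sqrt s).
Proof.
move=> s0; apply: EFin_inj; rewrite distr_funE PhiE -(drifted_cdf mu bW s0).
apply: measure_ae_eq; first exact: measurable_RV_le.
  by rewrite -[_ @^-1` _]setTI; apply: measurable_drifted.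
have [N [mN N0 sN]] := add_drift_ae.
exists N; split=> // w nw; apply: sN => H; apply: nw.
by rewrite /= !in_itv -(H s).
Qed.

Variables (t : R) (M : {RV P >-> R}).
Hypotheses (t0 : 0 < t) (hM : is_running_max (add_drift W mu) t M).

Local Notation Z := (drifted W mu).

Lemma running_max_drifted : {ae P, forall w,
  [set Z s w | s in `[0, t]] (M w) /\ ubound [set Z s w | s in `[0, t]] (M w)}.
Proof.
have [N1 [mN1 N10 sN1]] := hM; have [N2 [mN2 N20 sN2]] := add_drift_ae.
exists (N1 `|` N2); split.
- exact: measurableU.
- by rewrite null_set_setU.
- move=> w nw; apply: contrapT => /not_orP[n1 n2]; apply: nw.
  have E : forall s, add_drift W mu s w = Z s w.
    by apply: contrapT => h; apply: n2; exact: sN2.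
  have [[s st MZ] uM] : [set add_drift W mu s w | s in `[0, t]] (M w) /\
      ubound [set add_drift W mu s w | s in `[0, t]] (M w).
    by apply: contrapT => h; apply: n1; exact: sN1.
  split; first by exists s => //; rewrite -E.
  by move=> _ [r rt <-]; apply: uM; exists r => //; rewrite E.
Qed.

(** The classical distribution function of the maximum of a drifted Brownian motion, for m >= 0. At
    m = 0 it vanishes, which joins it continuously to the value 0 at negative levels. *)
Definition max_cdf (m : R) : R :=
  Phi ((m - mu * t) / Num.sqrt t) -
  expR (2 * mu * m) * Phi ((- m - mu * t) / Num.sqrt t).

(** The joint formula with terminal time [t] and [x = m]: since Z_t <= M almost surely, M <= m
    already implies Z_t <= m, and m - 2 m = - m merges the two reflected bounds. *)
Lemma running_max_distr_fun_ge0 m : 0 <= m -> distr_fun M m = max_cdf m.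
Proof.
move=> m0; have mM : measurable_fun [set: T] M by [].
have := max_drifted_distribution bW t0 (lexx t) m0 mM running_max_drifted m.
have mMm := measurable_RV_le M m.
have mZ y : measurable (Z t @^-1` `]-oo, y]).
  by rewrite -[_ @^-1` _]setTI; apply: measurable_drifted.
have -> : P (M @^-1` `]-oo, m] `&` Z t @^-1` `]-oo, m]) = P (M @^-1` `]-oo, m]).
  apply: measure_ae_eq => //; first exact: measurableI.
  have [N [mN N0 sN]] := max_ge_drifted t0 running_max_drifted.
  exists N; split=> // w nw; apply: sN => ZM; apply: nw.
  rewrite /= !in_itv/=; split=> [[]//|Mm]; split=> //.
  exact: le_trans Mm.
rewrite setIid -preimage_setI.
have -> : `]-oo, (- m)%R] `&` `]-oo, (m - 2 * m)%R] = `]-oo, - m]%classic :> set R.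
  by apply/seteqP; split=> x /=; rewrite !in_itv/=; [case|split=> //; lra].
rewrite !drifted_cdf// -!PhiE -distr_funE -EFinM -EFinD => -[].
by rewrite /max_cdf; lra.
Qed.

Lemma max_cdf0 : max_cdf 0 = 0.
Proof. by rewrite /max_cdf mulr0 expR0 mul1r oppr0 subrr. Qed.

(** For m < 0, monotonicity squeezes the value between 0 and the value at 0, which is 0. *)
Lemma running_max_distr_funE m : distr_fun M m = max_cdf (Num.max 0 m).
Proof.
have [m0|m0] := leP 0 m; first exact: running_max_distr_fun_ge0.
rewrite max_cdf0; apply/eqP; rewrite eq_le.
have /andP[-> _] := distr_fun_bnd M m; rewrite andbT.
by rewrite -max_cdf0 -running_max_distr_fun_ge0//; apply: distr_fun_nd; exact: ltW.
Qed.

Lemma max_cdf_continuous : continuous max_cdf.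
Proof.
have cPhi (a : R) (f : R -> R) : continuous f ->
    continuous (fun x => Phi ((f x - a) / Num.sqrt t)).
  move=> cf x.
  apply: (@continuous_comp R R R (fun x => (f x - a) / Num.sqrt t) (@Phi R));
    last exact: Phi_continuous.
  apply: cvgMr_tmp; apply: (@cvgB _ R^o); last exact: cvg_cst.
  exact: cf.
move=> x; apply: (@cvgB _ R^o).
  by apply: (cPhi _ idfun) => y; exact: cvg_id.
apply: cvgM.
  apply: (@continuous_comp R R R (fun x => 2 * mu * x) expR);
    last exact: continuous_expR.
  by apply: cvgMl_tmp; exact: cvg_id.
by apply: (cPhi _ -%R) => y; apply: (@cvgN _ R^o); exact: cvg_id.
Qed.

Lemma running_max_distr_fun_continuous : continuous (distr_fun M).
Proof.
have -> : distr_fun M = max_cdf \o Num.max 0.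
  by apply/funext => m; exact: running_max_distr_funE.
move=> x; apply: continuous_comp; last exact: max_cdf_continuous.
apply/cvgrPdist_le => e e0.
have /cvgrPdist_le/(_ _ e0) : y @[y --> x] --> x by exact: cvg_id.
by apply: filterS => y; apply: le_trans; exact: ler_dist_max.
Qed.

Lemma add_drift_distr_fun_continuous s : 0 < s ->
  continuous (distr_fun (add_drift W mu s)).
Proof.
move=> s0; have -> : distr_fun (add_drift W mu s) =
    (fun x => Phi ((x - mu * s) / Num.sqrt s)).
  by apply/funext => x; exact: add_drift_distr_fun.
move=> x.
apply: (@continuous_comp R R R (fun x => (x - mu * s) / Num.sqrt s) (@Phi R));
  last exact: Phi_continuous.
apply: cvgMr_tmp; apply: (@cvgB _ R^o); last exact: cvg_cst.
exact: cvg_id.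
Qed.

End drifted_marginals.

(** * The copula at the quantiles *)

Theorem mainTheorem3 (d : measure_display) (Omega : measurableType d)
  (R : realType) (P : probability Omega R) (W : R -> {RV P >-> R})
  (mu t T : R) (M : {RV P >-> R})
  (hW : standard_brownian_motion W)
  (ht : 0 < t) (htT : t <= T)
  (hM : is_running_max (add_drift W mu) t M) :
  let zeta1 := quantile (distr_fun M) in
  let Phi_inv := quantile (@Phi R) in
  forall u v : R, 0 < u < 1 -> 0 < v < 1 ->
    copula (add_drift W mu T) M u v =
      Phi2 (Phi_inv u) ((zeta1 v - mu * t) / Num.sqrt t) (Num.sqrt (t / T))
      - expR (2 * mu * zeta1 v) *
        Phi2 (Phi_inv u - 2 * zeta1 v / Num.sqrt T)
             ((- zeta1 v - mu * t) / Num.sqrt t) (Num.sqrt (t / T)).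
Proof.
move=> zeta1 Phi_inv u v u01 v01.
have T0 : 0 < T by exact: lt_le_trans htT.
have sT0 : 0 < Num.sqrt T by rewrite sqrtr_gt0.
have cX := add_drift_distr_fun_continuous hW T0 (mu := mu).
have cM := running_max_distr_fun_continuous hW ht hM.
(* [x] undoes the standardization of the terminal value, so that its distribution function at [x] is
   [u]. *)
set y := zeta1 v; pose x := Phi_inv u * Num.sqrt T + mu * T.
have xE : (x - mu * T) / Num.sqrt T = Phi_inv u by rewrite addrK mulfK// gt_eqF.
have Fx : distr_fun (add_drift W mu T) x = u.
  by rewrite add_drift_distr_fun// xE Phi_quantile.
have Fy : distr_fun M y = v by exact: distr_fun_quantile.
(* The reflection formula needs a nonnegative level: below 0 the maximum has distribution function
   0, while v > 0. *)
have y0 : 0 <= y.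
  rewrite leNgt; apply/negP => y0; have := running_max_distr_funE hW ht hM y.
  rewrite max_l ?ltW// max_cdf0 Fy => v0.
  by move: v01; rewrite v0 ltxx.
rewrite -{1}Fx -{1}Fy copula_distr_fun//; apply: EFin_inj.
have mM : measurable_fun [set: Omega] M by [].
have hMZ := running_max_drifted hW hM.
have := max_drifted_distribution hW ht htT y0 mM hMZ x.
have mMy := measurable_RV_le M y.
have mZ s z : measurable (drifted W mu s @^-1` `]-oo, z]).
  by rewrite -[_ @^-1` _]setTI; apply: measurable_drifted.
have -> : P (M @^-1` `]-oo, y] `&` drifted W mu T @^-1` `]-oo, x]) =
    (joint_distr_fun (add_drift W mu T) M x y)%:E.
  have jE : [set w | add_drift W mu T w <= x /\ M w <= y] =
      add_drift W mu T @^-1` `]-oo, x] `&` M @^-1` `]-oo, y].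
    by apply/seteqP; split=> w; rewrite /= !in_itv.
  have mX := measurable_RV_le (add_drift W mu T) x.
  rewrite /joint_distr_fun jE fineK; last first.
    by apply: fin_num_measure; exact: measurableI.
  rewrite setIC; apply: measure_ae_eq; [exact: measurableI..|].
  have [N [mN N0 sN]] := add_drift_ae mu hW.
  exists N; split=> // w nw; apply: sN => H; apply: nw.
  by rewrite /= !in_itv -(H T).
rewrite !drifted_bivariate_cdf// -EFinM -EFinD xE => -[].
have -> : (x - 2 * y - mu * T) / Num.sqrt T = Phi_inv u - 2 * y / Num.sqrt T.
  by rewrite -xE -mulrBl; congr (_ / _); ring.
by move=> <-; rewrite addrK.
Qed.
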